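(* Let $K\subset\mathbb R^2$ be a convex polygon symmetric with respect to the origin, let $f_1,\dots,f_n\colon\mathbb R^2\to\mathbb R$ be linear functions such that $f_i|_K\le1$ for all $i$, and let $p_1,\dots,p_n$ be nonnegative real numbers such that $\sum_{i=1}^np_i=1$. Then $$\Bigl|\sum_{1\le i<j\le n}p_ip_j\,f_i\wedge f_j\Bigr|\le\sum_{1\le i<j\le n}p_ip_j\,|f_i\wedge f_j|\le\frac1{A(K)}.$$ In addition, if $K$ is a convex $2n$-gon $a_1a_2\dots a_{2n}$, each $f_i$ ($1\le i\le n$) is the supporting function of $K$ corresponding to its side $[a_ia_{i+1}]$ (that is, the linear function such that $f_i=1$ on $[a_ia_{i+1}]$), and $p_i=2A(\triangle 0a_ia_{i+1})/A(K)$ for $i=1,\dots,n$, then both inequalities turn into equalities.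
   Context: $A$ denotes Euclidean area in $\mathbb R^2$. Polygons are two-dimensional (have nonempty interior). The notation $a_1a_2\dots a_{2n}$ means that the distinct vertices are listed in cyclic order along the boundary, so that central symmetry gives $a_{i+n}=-a_i$. $\triangle 0a_ia_{i+1}$ is the triangle with vertices the origin, $a_i$, $a_{i+1}$. For linear functions $f,g$ on $\mathbb R^2$, $f\wedge g$ is the $2$-form $(f\wedge g)(u,v)=f(u)g(v)-f(v)g(u)$, and for a $2$-form $\eta$ on $\mathbb R^2$, $|\eta|=|\eta(e_1,e_2)|$, where $e_1,e_2$ is the standard basis. *)

(* Defs.v *)
From HB Require Import structures.
From mathcomp Require Import all_boot all_order all_algebra.
From mathcomp Require Import all_classical all_reals all_analysis.

Set Implicit Arguments.
Unset Strict Implicit.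
Unset Printing Implicit Defensive.

Import Order.TTheory GRing.Theory Num.Theory numFieldNormedType.Exports.

Local Open Scope classical_set_scope.
Local Open Scope ring_scope.
Local Open Scope convex_scope.

Notation plane R := (R^o * R^o)%type.

Section convexity.
Context {R : realType} {E : lmodType R}.

Definition conv_hull (X : set E) : set E := smallest (@convex_set R E) X.

Definition segment (a b : E) : set E :=
  [set ((a : convex_lmodType E) <| t |> b) | t in [set: {i01 R}]].

Definition extreme_point (K : set E) (x : E) : Prop :=
  x \in K /\
  forall (y z : E) (t : {i01 R}), y \in K -> z \in K ->
    0 < t%:num < 1 -> x = (y : convex_lmodType E) <| t |> z -> y = z.

End convexity.

Definition boundary (T : topologicalType) (A : set T) : set T :=
  closure A `\` A°.

Section plane_geometry.
Context {R : realType}.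
Local Notation E := (plane R).

(* [fine] maps infinite values to [0]: meaningful for sets of finite measure,
   such as polygons. *)
Definition area (A : set E) : R :=
  fine ((@lebesgue_measure R \x @lebesgue_measure R)%E A).

Definition triangle (a b c : E) : set E := conv_hull [set a; b; c].

Definition convex_polygon (K : set E) : Prop :=
  K° !=set0 /\ exists2 X : set E, finite_set X & K = conv_hull X.

Definition symmetric0 (K : set E) : Prop := forall x, K x -> K (- x).

(* [K] is the convex [m]-gon with vertices [a 0, ..., a (m - 1)] in cyclic order
   along the boundary, with either orientation; [ordS] is the cyclic successor,
   so that the side starting at the last vertex returns to [a 0]. A segment
   between two vertices lies in the boundary of [K] only if they are adjacent,
   hence the last condition is what forces the cyclic order. *)
Definition convex_gon (m : nat) (a : 'I_m -> E) (K : set E) : Prop :=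
  [/\ convex_polygon K,
      injective a,
      K = conv_hull (range a),
      forall i, extreme_point K (a i) &
      forall i, segment (a i) (a (ordS i)) `<=` boundary K].

Definition wedge (f g : E -> R) : E -> E -> R^o :=
  fun u v => f u * g v - f v * g u.

Definition form2_norm (eta : E -> E -> R^o) : R :=
  `|eta (1, 0) (0, 1)|.

End plane_geometry.

(* Main.v *)
Require Import Defs.
From HB Require Import structures.
From mathcomp Require Import all_boot all_order all_algebra.
From mathcomp Require Import all_classical all_reals all_analysis.
From mathcomp Require Import measurable_realfun ring lra.
Set Implicit Arguments.
Unset Strict Implicit.
Unset Printing Implicit Defensive.
Import Order.TTheory GRing.Theory Num.Theory numFieldNormedType.Exports.
Local Open Scope classical_set_scope.
Local Open Scope ring_scope.

(* Let [K] lie in the polygon [P] where [|f_i| <= 1] for all [i]. The points of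
   [P] at which [|f_i|] is the largest of the [|f_k|] form a cell [C_i] of area
   [d_i], so that [area K <= \sum_i d_i]. For fixed [j], the maps
   [(+- f_i, f_j)] send the cells [C_i] to disjoint subsets of the double cone
   [|v| <= |u| <= 1] of area [2], which they fill up when [d_j > 0]; hence
   [\sum_i d_i |f_i /\ f_j| <= 2], with equality when [d_j > 0]. The kernel
   [|f_i /\ f_j|] is conditionally negative definite, since in terms of slopes it
   is the distance [|s - t|]; applying this to [p - l d] for the right scalar [l]
   bounds the energy of [p] by [1 / \sum_i d_i].

   In the case of equality, [f_i /\ f_j] is the determinant of the [i]-th and
   [j]-th edge vectors divided by [det (a_i, a_i+1) det (a_j, a_j+1)], and with
   [D := \sum_i |det (a_i, a_i+1)|] the weights [|det (a_i, a_i+1)| / D] make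
   the signed sum telescope to [+- 1 / D]. The first part then gives
   [1 / D <= 1 / area K], while disjoint triangles in [K] give [D <= area K]. *)

(** * Lebesgue measure on the line under translations and dilations *)

Section lebesgue1.
Context {R : realType}.
Local Notation mR := (measurableTypeR R).
Local Notation leb := (@lebesgue_measure R).
Local Open Scope ereal_scope.

Let lebesgue_measure_bnd (b b' : bool) (x y : R) :
  leb [set` Interval (BSide b x) (BSide b' y)] =
  if (x < y)%R then (y - x)%:E else 0.
Proof. by rewrite lebesgue_measure_itv /= lte_fin EFinB. Qed.

(** Lebesgue measure is determined by its values on half-open intervals, so only the pushforward of
    such intervals has to be computed. *)
Lemma lebesgue_measure_translate (c : R) (A : set R) : measurable A ->
  leb [set y | A (y + c)%R] = leb A.
Proof.
move=> mA.
have mf : measurable_fun [set: R] (fun y : R => y + c)%R.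
  exact: measurable_funD.
apply/esym/(lebesgue_measure_unique (mu := pushforward leb ((fun y : R => y + c)%R : _ -> mR))) => //.
move=> _ [[a b]] _ <-; rewrite [RHS]/(leb (_ @^-1` _)).
rewrite (_ : _ @^-1` _ = `](a - c)%R, (b - c)%R]%classic); last first.
  by apply/seteqP; split => y /=; rewrite !in_itv /= ltrBlDr lerBrDr.
rewrite [LHS]lebesgue_measure_bnd [RHS]lebesgue_measure_bnd ltrD2r; case: ifP => // _.
by congr EFin; rewrite opprB addrA subrK.
Qed.

Lemma lebesgue_measure_scale (b : R) (A : set R) : (b != 0)%R -> measurable A ->
  `|b|%:E * leb [set y | A (b * y)%R] = leb A.
Proof.
move=> b0 mA.
have mf : measurable_fun [set: R] (fun y : R => b * y)%R.
  exact: measurable_funM.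
pose pf : {measure set mR -> \bar R} := pushforward leb ((fun y : R => b * y)%R : _ -> mR).
pose m : {measure set mR -> \bar R} := mscale (NngNum (normr_ge0 b)) (pf mf).
apply/esym/(lebesgue_measure_unique (mu := m)) => //.
move=> _ [[x y]] _ <-; change (leb `]x, y]%classic = `|b|%:E * leb ((fun z => b * z)%R @^-1` `]x, y]%classic)).
have [b_gt0|b_lt0|] := ltrgtP 0%R b; last by move=> b0'; rewrite -b0' eqxx in b0.
- rewrite (_ : _ @^-1` _ = `](x / b)%R, (y / b)%R]%classic); last first.
    by apply/seteqP; split => z /=; rewrite !in_itv /= ltr_pdivrMr// ler_pdivlMr// mulrC.
  rewrite [LHS]lebesgue_measure_bnd [X in _ * X]lebesgue_measure_bnd ltr_pM2r ?invr_gt0//; case: ifP => _; last by rewrite mule0.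
  by rewrite gtr0_norm// -EFinM; congr EFin; field; rewrite gt_eqF.
(* A negative factor reverses the interval and exchanges its open and closed ends. *)
- rewrite (_ : _ @^-1` _ = `[(y / b)%R, (x / b)%R[%classic); last first.
    by apply/seteqP; split => z /=; rewrite !in_itv /= ltr_ndivlMr// ler_ndivrMr// andbC mulrC.
  rewrite [LHS]lebesgue_measure_bnd [X in _ * X]lebesgue_measure_bnd ltr_nM2r ?invr_lt0//; case: ifP => _; last by rewrite mule0.
  by rewrite ltr0_norm// -EFinM; congr EFin; field; rewrite lt_eqF.
Qed.

End lebesgue1.

(** * Lebesgue measure on the plane under invertible linear maps *)

Section linear_maps.
Context {R : realType}.
Local Notation mR := (measurableTypeR R).
Local Notation leb := (@lebesgue_measure R).
Local Open Scope ereal_scope.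

Definition mu2 : set (mR * mR) -> \bar R := (leb \x leb)%E.

HB.instance Definition _ := Measure.on mu2.

(** For an invertible linear map [T], [k] is the absolute value of the determinant. Working with
    preimages keeps measurability automatic and makes the property stable under composition. *)
Definition rescales (k : R) (T : mR * mR -> mR * mR) :=
  measurable_fun setT T /\
  forall A, measurable A -> k%:E * mu2 (T @^-1` A) = mu2 A.

Lemma rescales_comp k k' T T' : rescales k T -> rescales k' T' ->
  rescales (k' * k)%R (T' \o T).
Proof.
move=> [mT HT] [mT' HT']; split; first exact: measurableT_comp.
move=> A mA; rewrite comp_preimage EFinM -muleA HT ?HT'//.
by rewrite -[X in measurable X]setTI; exact: mT'.
Qed.

Lemma rescales_swap : rescales 1 (fun z => (z.2, z.1)).
Proof.
have mS : measurable_fun setT (fun z : mR * mR => (z.2, z.1) : mR * mR).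
  by apply/measurable_fun_pairP; split; [exact: measurable_snd|exact: measurable_fst].
split=> // A mA; rewrite mul1e; apply/esym.
apply: (@product_measure_unique _ _ _ _ _ leb leb (pushforward mu2 (fun z : mR * mR => (z.2, z.1) : mR * mR))) => //.
move=> B C mB mC.
change (mu2 ((fun z : mR * mR => (z.2, z.1)) @^-1` (B `*` C)) = leb B * leb C).
rewrite (_ : _ @^-1` _ = C `*` B); last first.
  by apply/seteqP; split => z /= [].
by rewrite /mu2 product_measure1E// muleC.
Qed.

Lemma rescales_shear (c : R) : rescales 1 (fun z => (z.1, z.2 + c * z.1)%R).
Proof.
split.
  apply/measurable_fun_pairP; split; first exact: measurable_fst.
  apply: measurable_funD; first exact: measurable_snd.
  apply: measurable_funM; [exact: measurable_cst|exact: measurable_fst].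
move=> A mA; rewrite mul1e; apply: eq_integral => x _ /=.
rewrite -(lebesgue_measure_translate (c * x)%R (A := xsection A x)).
  by congr (leb _); apply/seteqP; split => y; rewrite /xsection /= !inE.
exact: measurable_xsection.
Qed.

Lemma rescales_scale (b : R) : (b != 0)%R -> rescales `|b|%R (fun z => (z.1, b * z.2)%R).
Proof.
move=> b0.
have mS : measurable_fun setT (fun z : mR * mR => (z.1, b * z.2)%R : mR * mR).
  apply/measurable_fun_pairP; split; first exact: measurable_fst.
  apply: measurable_funM; [exact: measurable_cst|exact: measurable_snd].
split=> // A mA.
rewrite -ge0_integralZl//; last first.
  by apply: measurable_fun_xsection; rewrite -[X in measurable X]setTI; exact: mS.
apply: eq_integral => x _ /=.
rewrite -(lebesgue_measure_scale b0 (A := xsection A x)).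
  by congr (_ * leb _); apply/seteqP; split => y; rewrite /xsection /= !inE.
exact: measurable_xsection.
Qed.

(** Gaussian elimination: if [a] is nonzero, the map is a product of swaps, shears and dilations by
    the pivots [a] and [(a * d - b * c) / a]. If [a] is zero, then [b] is not, and swapping the
    variables reduces to the first case. *)
Lemma rescales_linear (a b c d : R) : (a * d - b * c != 0)%R ->
  rescales `|a * d - b * c|%R (fun z => (a * z.1 + b * z.2, c * z.1 + d * z.2)%R).
Proof.
have main a' b' c' d' : (a' != 0 -> a' * d' - b' * c' != 0 ->
    rescales `|a' * d' - b' * c'| (fun z => (a' * z.1 + b' * z.2, c' * z.1 + d' * z.2)))%R.
  move=> a0 D0.
  have k0 : ((a' * d' - b' * c') / a' != 0)%R by rewrite mulf_neq0 ?invr_eq0.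
  have := rescales_comp (rescales_comp (rescales_comp (rescales_comp (rescales_comp
    rescales_swap (rescales_scale a0)) (rescales_shear b'))
    rescales_swap) (rescales_scale k0)) (rescales_shear (c' / a')%R).
  rewrite !mul1r mulr1 -normrM divfK//.
  congr rescales; apply/funext => -[x y] /=; congr pair.
  by field.
move=> D0; have [a0|a0] := eqVneq a 0%R; last exact: main.
have b0 : (b != 0)%R by apply: contraNneq D0 => ->; rewrite a0; apply/eqP; ring.
have D0' : (b * c - a * d != 0)%R by rewrite -opprB oppr_eq0.
have := rescales_comp rescales_swap (main b a d c b0 D0').
rewrite mulr1 distrC; congr rescales; apply/funext => -[x y] /=.
by rewrite addrC (addrC (d * y)%R).
Qed.
End linear_maps.

(** * Calculus of areas as real numbers *)

Section area_theory.
Context {R : realType}.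
Local Notation mR := (measurableTypeR R).
Local Notation leb := (@lebesgue_measure R).
Implicit Types A B : set (plane R).

(** Since [area] sends an infinite measure to [0], additivity over the reals has to carry finiteness
    along with measurability. *)
Definition fin_area A := measurable A /\ (mu2 A < +oo)%E.

Lemma fin_areaI A : measurable A -> (mu2 A < +oo)%E -> fin_area A.
Proof. by []. Qed.

Lemma fin_area_lty A : fin_area A -> (mu2 A < +oo)%E.
Proof. by case. Qed.

(** The integral is a supremum over the simple functions below the section measure, which is
    monotone as an outer measure. The argument covers arbitrary sets, so a polygon can be compared
    with unions of cells or triangles. *)
Lemma mu2_le A B : A `<=` B -> (mu2 A <= mu2 B)%E.
Proof.
move=> AB; rewrite /mu2 /product_measure1 !ge0_integralTE; last 2 first.
- by move=> x; exact: measure_ge0.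
- by move=> x; exact: measure_ge0.
apply: ereal_sup_le => _ [h hA <-]; exists h => // x.
apply: le_trans (hA x) _; apply: le_outer_measure.
by move=> y; rewrite /xsection /= !inE; exact: AB.
Qed.

Lemma mu2_area A : (mu2 A < +oo)%E -> mu2 A = (area A)%:E.
Proof. by move=> Aoo; rewrite [RHS]fineK// ge0_fin_numE. Qed.

Lemma area_null A : mu2 A = 0%E -> area A = 0.
Proof. by move=> A0; rewrite [LHS]/(fine (mu2 A)) A0. Qed.

Lemma area_ge0 A : 0 <= area A.
Proof. by rewrite fine_ge0//; exact: (measure_ge0 mu2). Qed.

Opaque area mu2.

Lemma area_le A B : A `<=` B -> (mu2 B < +oo)%E -> area A <= area B.
Proof.
move=> AB Boo; rewrite -lee_fin -!mu2_area ?mu2_le//.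
exact: le_lt_trans (mu2_le AB) Boo.
Qed.

Definition lin (a b c d : R) (z : plane R) : plane R :=
  (a * z.1 + b * z.2, c * z.1 + d * z.2).

Lemma measurable_lin_preimage a b c d A :
  measurable A -> measurable (lin a b c d @^-1` A).
Proof.
move=> mA; rewrite -[X in measurable X]setTI.
suff : measurable_fun setT (lin a b c d) by apply.
apply/measurable_fun_pairP; split; apply: measurable_funD;
  apply: measurable_funM; try exact: measurable_cst;
  [exact: measurable_fst|exact: measurable_snd|exact: measurable_fst|exact: measurable_snd].
Qed.

Lemma mu2_lin a b c d A : a * d - b * c != 0 -> measurable A ->
  (`|a * d - b * c|%:E * mu2 (lin a b c d @^-1` A) = mu2 A)%E.
Proof. by move=> /rescales_linear[_]; exact. Qed.

Lemma fin_area_lin a b c d A : a * d - b * c != 0 -> fin_area A ->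
  fin_area (lin a b c d @^-1` A).
Proof.
move=> D0 [mA Aoo]; split; first exact: measurable_lin_preimage.
rewrite ltey; apply/eqP => Poo; move: Aoo; rewrite -(mu2_lin D0 mA) Poo.
by rewrite mulry gtr0_sg ?normr_gt0// mul1e.
Qed.

Lemma area_lin a b c d A : a * d - b * c != 0 -> fin_area A ->
  `|a * d - b * c| * area (lin a b c d @^-1` A) = area A.
Proof.
move=> D0 [mA Aoo]; apply: EFin_inj; rewrite EFinM -!mu2_area//; last first.
  by have [] := fin_area_lin D0 (conj mA Aoo).
exact: mu2_lin.
Qed.

(** Turns images into preimages under the inverse matrix, the form in which [rescales] applies. *)
Lemma lin_image a b c d A : a * d - b * c != 0 ->
  let D := a * d - b * c in
  lin a b c d @` A = lin (d / D) (- b / D) (- c / D) (a / D) @^-1` A.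
Proof.
move=> D0 D; have K (z : plane R) : lin (d / D) (- b / D) (- c / D) (a / D) (lin a b c d z) = z.
  by case: z => x y; rewrite /lin /= /D; congr pair; field.
apply/seteqP; split => [_ [z Az <-]|z Az]; first by rewrite /preimage /= K.
exists (lin (d / D) (- b / D) (- c / D) (a / D) z) => //.
by case: z {Az} => x y; rewrite /lin /= /D; congr pair; field.
Qed.

Lemma fin_area_image a b c d A : a * d - b * c != 0 -> fin_area A ->
  fin_area (lin a b c d @` A).
Proof.
move=> D0 fA; rewrite lin_image//; apply: fin_area_lin => //.
rewrite (_ : _ - _ = (a * d - b * c)^-1) ?invr_eq0//; by field.
Qed.

Lemma area_image a b c d A : a * d - b * c != 0 -> fin_area A ->
  area (lin a b c d @` A) = `|a * d - b * c| * area A.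
Proof.
move=> D0 fA; set D := a * d - b * c.
have E : d / D * (a / D) - (- b / D) * (- c / D) = D^-1 by rewrite /D; field.
rewrite lin_image// -[in RHS](@area_lin (d / D) (- b / D) (- c / D) (a / D))//; last first.
  by rewrite E invr_eq0.
by rewrite E normfV mulVKf// normr_eq0.
Qed.

Lemma fin_areaU A B : fin_area A -> fin_area B -> fin_area (A `|` B).
Proof.
move=> [mA Aoo] [mB Boo]; split; first exact: measurableU.
by apply: (le_lt_trans (@measureU2 _ _ _ mu2 A B mA mB)); exact: lte_add_pinfty.
Qed.

Lemma areaU A B : fin_area A -> fin_area B -> A `&` B = set0 ->
  area (A `|` B) = area A + area B.
Proof.
move=> [mA Aoo] [mB Boo] AB0; apply: EFin_inj; rewrite EFinD -!mu2_area//.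
  exact: (measureU mu2).
by have [] := fin_areaU (conj mA Aoo) (conj mB Boo).
Qed.

Lemma fin_area_sub A B : measurable A -> A `<=` B -> fin_area B -> fin_area A.
Proof. by move=> mA AB [_ Boo]; split=> //; exact: le_lt_trans (mu2_le AB) Boo. Qed.

Lemma fin_area_bigcup (I : finType) (P : pred I) (F : I -> set (plane R)) :
  (forall i, P i -> fin_area (F i)) -> fin_area (\big[setU/set0]_(i | P i) F i).
Proof.
move=> fF; elim/big_rec : _ => [|i A Pi fA]; last by apply: fin_areaU => //; exact: fF.
by split=> //; rewrite measure0.
Qed.

Lemma area_bigcup (I : finType) (P : pred I) (F : I -> set (plane R)) :
  (forall i, P i -> fin_area (F i)) ->
  (forall i j z, P i -> P j -> F i z -> F j z -> i = j) ->
  area (\big[setU/set0]_(i | P i) F i) = \sum_(i | P i) area (F i).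
Proof.
move=> fF tF.
pose H (r : seq I) := uniq r ->
  fin_area (\big[setU/set0]_(i <- r | P i) F i) /\
  area (\big[setU/set0]_(i <- r | P i) F i) = \sum_(i <- r | P i) area (F i).
suff /(_ (index_enum_uniq I))[] : H (index_enum I) by [].
elim: (index_enum I) => [_|i r IH /= /andP[ir ur]].
  rewrite !big_nil; split; first by split=> //; rewrite measure0.
  by rewrite area_null// measure0.
have [fr ar] := IH ur; rewrite !big_cons; case: ifPn => // Pi.
split; first by apply: fin_areaU => //; exact: fF.
rewrite areaU ?ar//; first exact: fF.
rewrite -subset0 => z [Fiz]; rewrite -bigcup_seq_cond => -[j /= /andP[jr Pj] Fjz].
by rewrite (tF _ _ _ Pi Pj Fiz Fjz) jr in ir.
Qed.

Lemma area_le_sum (I : finType) (P : pred I) (F : I -> set (plane R)) A :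
  (forall i, P i -> fin_area (F i)) -> A `<=` \big[setU/set0]_(i | P i) F i ->
  area A <= \sum_(i | P i) area (F i).
Proof.
move=> fF AF; apply: (@le_trans _ _ (area (\big[setU/set0]_(i | P i) F i))).
  by apply: area_le => //; have [] := fin_area_bigcup fF.
suff [] : fin_area (\big[setU/set0]_(i | P i) F i) /\
  area (\big[setU/set0]_(i | P i) F i) <= \sum_(i | P i) area (F i) by [].
elim/big_rec2 : _ => [|i x B Pi [fB lB]].
  by split; [split=> //; rewrite measure0|rewrite area_null// measure0].
have fUB : fin_area (F i `|` B) by apply: fin_areaU => //; exact: fF.
split=> //; apply: (@le_trans _ _ (area (F i) + area B)); last by rewrite lerD2l.
have [[mi ioo] [mB Boo]] := (fF _ Pi, fB).
rewrite -lee_fin EFinD -!mu2_area//; last by have [] := fUB.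
exact: measureU2.
Qed.

End area_theory.

Opaque area mu2 fin_area.

(** * Areas of the square, the double cone and the standard triangle *)

Section standard_areas.
Context {R : realType}.
Local Notation mR := (measurableTypeR R).
Local Notation leb := (@lebesgue_measure R).
Implicit Types A B : set (plane R).

Lemma measurable_coordE (a b : R) :
  measurable_fun setT (fun z : plane R => a * z.1 + b * z.2).
Proof.
apply: measurable_funD; apply: measurable_funM; try exact: measurable_cst;
  [exact: measurable_fst|exact: measurable_snd].
Qed.

Lemma measurable_set_bool (P : plane R -> bool) :
  measurable_fun setT P -> measurable [set z | P z].
Proof.
move=> mP; rewrite -[X in measurable X]setTI.
exact: (mP measurableT [set true]).
Qed.

Definition square : set (plane R) := [set z | `|z.1| <= 1 /\ `|z.2| <= 1].
(** [s] tells whether the diagonals are included: the closed cone will contain the images of the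
    cells, and the open one will be covered by them. *)
Definition cone (s : bool) : set (plane R) :=
  [set z | (`|z.2| < `|z.1| ?<= if s) /\ `|z.1| <= 1].

Lemma squareE : square = `[-1, 1]%classic `*` `[-1, 1]%classic.
Proof.
by apply/seteqP; split => -[x y] /=; rewrite !in_itv /= -!ler_norml.
Qed.

Lemma mu2_square : mu2 square = 4%R%:E.
Proof.
have E : leb `[-1 : R, 1]%classic = 2%R%:E.
  by rewrite lebesgue_measure_itv /= lte_fin ifT; [congr EFin; ring|lra].
rewrite squareE; pose I := `[-1 : R, 1]%classic; transitivity (leb I * leb I)%E.
  by apply: product_measure1E; exact: measurable_itv.
by rewrite !E -EFinM; congr EFin; ring.
Qed.

Lemma fin_area_square : fin_area square.
Proof. apply: fin_areaI; last by rewrite mu2_square ltry.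
by rewrite squareE; exact: measurableX. Qed.

Let m1 : measurable_fun setT (fun z : plane R => `|z.1|).
Proof. by apply: measurableT_comp => //; exact: measurable_fst. Qed.
Let m2 : measurable_fun setT (fun z : plane R => `|z.2|).
Proof. by apply: measurableT_comp => //; exact: measurable_snd. Qed.

Lemma fin_area_cone s : fin_area (cone s).
Proof.
apply: fin_area_sub fin_area_square; last first.
  move=> z [/lteifW z21 z1]; split=> //; exact: le_trans z21 z1.
rewrite /cone (_ : mkset _ = [set z | (`|z.2| < `|z.1| ?<= if s)] `&` [set z | `|z.1| <= 1])//.
apply: measurableI; apply: measurable_set_bool; last exact: measurable_fun_ler.
by case: s; [exact: measurable_fun_ler|exact: measurable_fun_ltr].
Qed.

Let diag : set (plane R) := [set z | `|z.2| = `|z.1| /\ `|z.1| <= 1].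

Let diagE : diag = cone true `\` cone false.
Proof.
apply/seteqP; split => z /=; rewrite /diag /cone /=.
  by move=> [e z1]; split; [rewrite e|case; rewrite e ltxx].
move=> [[le z1] nlt]; split=> //; apply/eqP; rewrite eq_le le /= leNgt.
by apply/negP => lt; apply: nlt.
Qed.

Let fin_diag : fin_area diag.
Proof.
apply: (@fin_area_sub _ _ (cone true)); last exact: fin_area_cone.
  by rewrite diagE; apply: measurableD; have [] := fin_area_cone true; have [] := fin_area_cone false.
by rewrite diagE; exact: subDsetl.
Qed.

Let area_diag : area diag = 0.
Proof.
apply: area_null.
apply: integral0_eq => x _ /=; apply/eqP; rewrite -measure_le0.
apply: (@le_trans _ _ (leb [set x; - x])).
  apply: le_outer_measure => y; rewrite /xsection /= inE => -[/= /eqP + _].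
  by rewrite eqr_norm2 => /orP[/eqP ->|/eqP ->]; [left|right].
by rewrite countable_lebesgue_measure0//; apply: finite_set_countable; exact: finite_set2.
Qed.

(** The two versions differ by the diagonals, a null set. The closed cone and the open cone with
    exchanged coordinates partition the square, of area [4]. *)
Lemma area_cone s : area (cone s) = 2.
Proof.
have e : area (cone true) = area (cone false).
  rewrite -[RHS]addr0 -area_diag -areaU; last 3 first.
  - exact: fin_area_cone.
  - exact: fin_diag.
  - by rewrite diagE -subset0 => z [? []].
  by congr area; rewrite diagE setDUK// => z [/lteifW]/= ? ?; split.
suff : area (cone true) + area (cone false) = 4.
  by case: s; move: e; move: (area (cone true)) (area (cone false)) => u v; lra.
have D0 : 0 * 0 - 1 * 1 != 0 :> R by apply/eqP => h; lra.
rewrite -(area_lin D0 (fin_area_cone false)).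
rewrite (_ : `|_| = 1) ?mul1r; last by rewrite (_ : _ - _ = -1) ?normrN1//; ring.
rewrite -areaU; last 3 first.
- exact: fin_area_cone.
- exact: (fin_area_lin D0 (fin_area_cone false)).
- rewrite -subset0 => -[x y]; rewrite /cone /lin /= !mul0r !mul1r add0r addr0 => -[[/= le _] [lt _]].
  by move: (le_lt_trans le lt); rewrite ltxx.
rewrite (_ : _ `|` _ = square); first by apply: EFin_inj; rewrite -mu2_area ?mu2_square ?ltry.
apply/seteqP; split => -[x y]; rewrite /cone /lin /square /= !mul0r !mul1r add0r addr0.
  by case=> [] [h1 h2]; split => //; apply: le_trans h2 => //; exact: ltW.
by case=> h1 h2; have [h|h] := leP `|y| `|x|; [left|right].
Qed.

(* [s] tells whether the two sides at the origin are included. *)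
Definition std_triangle (s : bool) : set (plane R) :=
  [set z | [/\ 0 < z.1 ?<= if s, 0 < z.2 ?<= if s & z.1 + z.2 <= 1]].

Let half (s : bool) : set (plane R) := [set z | (`|z.2| < z.1 ?<= if s) /\ z.1 <= 1].

Let measurable_half s : measurable (half s).
Proof.
rewrite /half (_ : mkset _ = [set z | (`|z.2| < z.1 ?<= if s)] `&` [set z | z.1 <= 1])//.
have ? := @measurable_fst _ _ mR mR.
apply: measurableI; apply: measurable_set_bool; last exact: measurable_fun_ler.
by case: s; [exact: measurable_fun_ler|exact: measurable_fun_ltr].
Qed.

Let half_cone s : half s `<=` cone s.
Proof.
move=> z [h1 h2]; have z0 : 0 <= z.1 by exact: le_trans (normr_ge0 _) (lteifW h1).
by split; rewrite (ger0_norm z0).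
Qed.

Let fin_half s : fin_area (half s).
Proof. exact: (fin_area_sub (measurable_half s) (@half_cone s) (fin_area_cone s)). Qed.

(** The open half and its opposite partition the open double cone; closing it up adds only points of
    the diagonals. *)
Let area_half s : area (half s) = 1.
Proof.
have a1 : area (half false) = 1.
  have D0 : -1 * -1 - 0 * 0 != 0 :> R by apply/eqP => h; lra.
  apply: (@mulfI _ 2) => //; rewrite mulr1 mulr_natl mulr2n -(area_cone false).
  rewrite -[in X in _ + X](area_lin D0 (fin_half false)).
  rewrite (_ : `|_| = 1) ?mul1r; last by rewrite (_ : _ - _ = 1) ?normr1//; ring.
  rewrite -areaU; last 3 first.
  - exact: fin_half.
  - exact: (fin_area_lin D0 (fin_half false)).
  - rewrite -subset0 => -[x y]; rewrite /half /lin /= !mul0r !mulN1r add0r addr0 normrN.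
    move=> [[h1 _] [h2 _]]; have := normr_ge0 y; lra.
  congr area; apply/seteqP; split => -[x y]; rewrite /cone /half /lin /= !mul0r !mulN1r add0r addr0 normrN.
    move=> [] [/= h1 h2]; have y0 := normr_ge0 y.
      have x0 : 0 <= x by lra.
      by rewrite (ger0_norm x0).
    have x0 : x <= 0 by lra.
    by rewrite (ler0_norm x0).
  move=> [h1 h2]; have [x0|/ltW x0] := leP 0 x; [left|right]; move: h1 h2.
    by rewrite (ger0_norm x0).
  by rewrite (ler0_norm x0).
case: s => //; apply/eqP; rewrite eq_le; apply/andP; split.
  rewrite -[leRHS]addr0 -a1 -area_diag -areaU; [|exact: fin_half|exact: fin_diag|].
    apply: area_le; last exact: fin_area_lty (fin_areaU (fin_half false) fin_diag).
    move=> z [h1 h2]; have [h|h|h] := ltgtP `|z.2| z.1; first by left.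
      by move: h1; rewrite /= leNgt h.
    by right; rewrite /diag /= -h normr_id h.
  rewrite -subset0 => z [[/= h _] [h' _]]; move: h; rewrite h' ltNge.
  by rewrite ler_norm.
rewrite -a1; apply: area_le; last exact: fin_area_lty (fin_half true).
by move=> z [/= /ltW h1 h2].
Qed.

Let D2 : 1 * -1 - 1 * 1 != 0 :> R. Proof. by apply/eqP => h; lra. Qed.

Let std_triangleE s : std_triangle s = lin 1 1 1 (-1) @^-1` half s.
Proof.
apply/seteqP; split => -[x y]; rewrite /std_triangle /half /lin /= !mul1r mulN1r.
  by case: s => /= -[/= h1 h2 h3]; split=> //=; rewrite ?ler_norml ?ltr_norml; apply/andP; split; lra.
by case: s => /= -[/=]; rewrite ?ler_norml ?ltr_norml => /andP[h1 h2] h3; split => //; lra.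
Qed.

Lemma fin_area_std_triangle s : fin_area (std_triangle s).
Proof. by rewrite std_triangleE; exact: (fin_area_lin D2 (fin_half s)). Qed.

(** The map [(x, y) -> (x + y, x - y)], of determinant [-2], carries the triangle onto a half cone
    of area [1]. *)
Lemma area_std_triangle s : area (std_triangle s) = 2^-1.
Proof.
apply: (@mulfI _ 2) => //; rewrite divff// std_triangleE -[RHS](area_half s).
rewrite -(area_lin D2 (fin_half s)); congr (_ * _).
by rewrite (_ : _ - _ = -2) ?normrN ?ger0_norm//; ring.
Qed.

End standard_areas.

(** * Conditionally negative definite kernels and the energy estimate *)

Section energy.
Context {R : realFieldType} {I : finType}.
Implicit Types (c s x y z : I -> R).

(** The kernel [min (s, t) - m] is positive semidefinite on [[m, +oo[]. The induction removes an
    index [i0] with the smallest [s i0], whose row and column only involve the value [s i0], and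
    raises the lower bound from [m] to [s i0] for the remaining indices. *)
Lemma min_kernel_ge (A : {set I}) c s (m : R) :
  (forall i, i \in A -> m <= s i) ->
  m * (\sum_(i in A) c i) ^+ 2
    <= \sum_(i in A) \sum_(j in A) c i * c j * Num.min (s i) (s j).
Proof.
have [n] := ubnP #|A|; elim: n A m => // n IHn A m leAn mA.
have [->|[i iA]] := set_0Vmem A; first by rewrite !big_set0 expr0n mulr0.
have [i0 /= i0A i0P] := arg_minP s iA; have {}i0A : i0 \in A by [].
have s0 j : j \in A :\ i0 -> s i0 <= s j by rewrite !inE => /andP[_ /i0P].
have /IHn /(_ s0) : (#|A :\ i0| < n)%N by move: leAn; rewrite (cardsD1 i0) i0A.
rewrite !(big_setD1 i0 i0A) /= minxx.
have -> : \sum_(j in A :\ i0) c i0 * c j * Num.min (s i0) (s j)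
    = c i0 * s i0 * \sum_(j in A :\ i0) c j.
  by rewrite mulr_sumr; apply: eq_bigr => j /s0 /min_idPl ->; rewrite mulrAC.
have -> : \sum_(j in A :\ i0) \sum_(k in A) c j * c k * Num.min (s j) (s k)
    = c i0 * s i0 * (\sum_(j in A :\ i0) c j) +
      \sum_(j in A :\ i0) \sum_(k in A :\ i0) c j * c k * Num.min (s j) (s k).
  rewrite mulr_sumr -big_split; apply: eq_bigr => j jA /=.
  rewrite (big_setD1 i0 i0A) /=; congr +%R.
  by have /min_idPr -> := s0 _ jA; ring.
set C := \sum_(j in _) c j; set M := \sum_(j in _) _ => IH.
have := mA _ i0A; rewrite -subr_ge0 => /mulr_ge0 /(_ (sqr_ge0 (c i0 + C))).
nra.
Qed.

(* Write [|s - t| = s + t - 2 min s t]. *)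
Lemma dist_kernel_le0 c s : \sum_i c i = 0 ->
  \sum_i \sum_j c i * c j * `|s i - s j| <= 0.
Proof.
(* Any common lower bound of the [s i] would do: it gets multiplied by the square of
   [\sum_i c i = 0]. *)
move=> c0; pose m := - \sum_i `|s i|.
have ms i : i \in [set: I]%SET -> m <= s i.
  move=> _; rewrite /m lerNl (bigD1 i)//= -[- s i]addr0 lerD//; last exact: sumr_ge0.
  by rewrite -normrN ler_norm.
have := min_kernel_ge c ms.
have E (F : I -> R) : \sum_(i in [set: I]%SET) F i = \sum_i F i by apply: eq_bigl => i; rewrite inE.
rewrite !E c0 expr0n mulr0.
have -> : \sum_i \sum_j c i * c j * `|s i - s j| =
  - (2 * \sum_(i in [set: I]%SET) \sum_(j in [set: I]%SET) c i * c j * Num.min (s i) (s j)).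
  transitivity (\sum_i \sum_j (c i * s i * c j + c i * (c j * s j) - 2 * (c i * c j * Num.min (s i) (s j)))).
    apply: eq_bigr => i _; apply: eq_bigr => j _.
    by case: lerP => _; ring.
  under eq_bigr do rewrite sumrB big_split /= -!mulr_sumr c0 mulr0 add0r.
  rewrite sumrB -mulr_suml c0 mul0r sub0r -mulr_sumr.
  by rewrite E; under [in RHS]eq_bigr do rewrite E.
by rewrite !E; lra.
Qed.

(** For nonzero [x i] and [x j] the kernel is [|x i| |x j|] times the distance of the slopes
    [y / x], so the distance kernel applies to the coefficients [c i * |x i|]. The forms with
    [x i = 0], recorded by [z], contribute only terms with the vanishing factor
    [\sum_i c i * |x i|]. *)
Lemma wedge_kernel_le0 c x y : \sum_i c i * `|x i| = 0 ->
  \sum_i \sum_j c i * c j * `|x i * y j - x j * y i| <= 0.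
Proof.
move=> c0; pose z i := if x i == 0 then `|y i| else 0.
have -> : \sum_i \sum_j c i * c j * `|x i * y j - x j * y i| =
    \sum_i \sum_j ((c i * `|x i|) * (c j * `|x j|) * `|y i / x i - y j / x j|
      + c i * z i * (c j * `|x j|) + c i * `|x i| * (c j * z j)).
  apply: eq_bigr => i _; apply: eq_bigr => j _; rewrite /z.
  have [xi|xi] := eqVneq (x i) 0; have [xj|xj] := eqVneq (x j) 0.
  - by rewrite xi xj !mul0r subr0 normr0; ring.
  - by rewrite xi !mul0r sub0r normrN normr0 normrM; ring.
  - by rewrite xj !mul0r subr0 normr0 normrM; ring.
  - have -> : y i / x i - y j / x j = - ((x i * y j - x j * y i) / (x i * x j)).
      by field; rewrite xi xj.
    rewrite normrN normrM normfV normrM; field.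
    by rewrite !normr_eq0 xi xj.
under eq_bigr do rewrite !big_split /= -!mulr_sumr c0 mulr0 addr0.
rewrite big_split /= -[X in _ + X]mulr_suml c0 mul0r addr0.
exact: dist_kernel_le0.
Qed.

(* [c = p - l q] with [l = (\sum p |x|) / (\sum q |x|)] is admissible in
   [wedge_kernel_le0]; when [\sum q |x| = 0], so is [c = q]. *)
Lemma wedge_kernel_bound (p q x y : I -> R) (D : R) :
  let M i j := `|x i * y j - x j * y i| in
  (forall i, 0 <= p i) -> (forall i, 0 <= q i) -> \sum_i p i = 1 ->
  \sum_i q i = D ->
  (forall j, \sum_i q i * M i j <= 2) ->
  (forall j, 0 < q j -> 2 <= \sum_i q i * M i j) ->
  (\sum_i \sum_j p i * p j * M i j) * D <= 2.
Proof.
move=> M p0 q0 p1 qD Mle Mge.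
have MC i j : M i j = M j i by rewrite /M distrC.
have D0 : 0 <= D by rewrite -qD sumr_ge0.
have qMq : 2 * D <= \sum_i \sum_j q i * q j * M i j.
  rewrite -qD mulr_sumr exchange_big ler_sum// => j _ /=.
  have -> : \sum_i q i * q j * M i j = q j * \sum_i q i * M i j.
    by rewrite mulr_sumr; apply: eq_bigr => i _; rewrite mulrCA mulrA.
  have [->|qj] := eqVneq (q j) 0; first by rewrite mulr0 mul0r.
  by rewrite mulrC ler_wpM2l ?Mge ?lt0r ?qj ?q0.
have pMq : \sum_i \sum_j p i * q j * M i j <= 2.
  rewrite [leRHS](_ : _ = 2 * \sum_i p i); last by rewrite p1 mulr1.
  rewrite mulr_sumr ler_sum// => i _.
  under eq_bigr do rewrite -mulrA MC.
  by rewrite -mulr_sumr mulrC ler_wpM2r.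
have P0 : 0 <= \sum_i p i * `|x i| by apply: sumr_ge0 => i _; rewrite mulr_ge0.
have Q0 : 0 <= \sum_i q i * `|x i| by apply: sumr_ge0 => i _; rewrite mulr_ge0.
have [Q1|Q1] := eqVneq (\sum_i q i * `|x i|) 0.
  have -> : D = 0 by have := wedge_kernel_le0 y Q1; lra.
  by rewrite mulr0.
pose l := (\sum_i p i * `|x i|) / (\sum_i q i * `|x i|).
have l0 : 0 <= l by rewrite divr_ge0.
have : \sum_i (p i - l * q i) * `|x i| = 0.
  under eq_bigr do rewrite mulrBl -mulrA.
  by rewrite sumrB -mulr_sumr divfK// subrr.
move=> /(wedge_kernel_le0 y).
have -> : \sum_i \sum_j (p i - l * q i) * (p j - l * q j) * M i j =
   \sum_i \sum_j p i * p j * M i j - 2 * l * (\sum_i \sum_j p i * q j * M i j)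
   + l ^+ 2 * \sum_i \sum_j q i * q j * M i j.
  have -> : 2 * l * (\sum_i \sum_j p i * q j * M i j) =
     l * (\sum_i \sum_j p i * q j * M i j) + l * (\sum_i \sum_j q i * p j * M i j).
    rewrite [in X in _ = _ + l * X]exchange_big /=.
    rewrite -mulrA mulr_natl mulr2n; congr (_ + l * _).
    by do 2 (apply: eq_bigr => ? _); rewrite MC (mulrC (p _)).
  rewrite !mulr_sumr -big_split -sumrB -big_split; apply: eq_bigr => i _ /=.
  rewrite !mulr_sumr -big_split -sumrB -big_split; apply: eq_bigr => j _ /=.
  by ring.
move: qMq pMq.
set a := \sum_i \sum_j q i * q j * M i j; set b := \sum_i \sum_j p i * q j * M i j.
set d := \sum_i \sum_j _; move: a b d => a b d qMq pMq H.
have h1 : l * b <= l * 2 by rewrite ler_wpM2l.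
have h2 : l ^+ 2 * (2 * D) <= l ^+ 2 * a by apply: ler_wpM2l => //; exact: sqr_ge0.
have h3 : d <= 4 * l - 2 * (l ^+ 2 * D) by lra.
(* Multiplied by [D], the bound [h3] reads [d * D <= 2 - 2 * (l * D - 1) ^+ 2]. *)
have := ler_wpM2r D0 h3; have := sqr_ge0 (l * D - 1).
by rewrite expr2; nra.
Qed.

End energy.

(** * Cells of the largest form and their images in the double cone *)

Lemma first_argmax {R : realDomainType} (n : nat) (g : 'I_n -> R) (i0 : 'I_n) :
  exists i, forall k, g k < g i ?<= if (i <= k)%N.
Proof.
have [m _ mP] := arg_maxP g (isT : xpredT i0).
have [i /eqP gi iP] := @arg_minnP _ m (fun i => g i == g m) (@nat_of_ord n) (eqxx _).
exists i => k; rewrite gi; have gk : g k <= g m by exact: mP.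
case: leqP => ik; first exact: gk.
rewrite /= lt_neqAle gk andbT; apply: contraL ik => /iP.
by rewrite -leqNgt.
Qed.

(* The cells cut the polygon [|x_i z_1 + y_i z_2| <= 1] into the double cones
   over its pairs of opposite sides. *)
Section cells.
Context {R : realType} {n : nat} (x y : 'I_n -> R).
Implicit Types (i j k : 'I_n) (z : plane R).

Let ev i z := x i * z.1 + y i * z.2.
Let M i j := `|x i * y j - x j * y i|.

(** Ties go to the smallest index, which makes the cells pairwise disjoint and not merely almost
    disjoint. *)
Definition cell i : set (plane R) :=
  [set z | `|x i * z.1 + y i * z.2| <= 1 /\
    forall k, `|x k * z.1 + y k * z.2| < `|x i * z.1 + y i * z.2| ?<= if (i <= k)%N].

Lemma measurable_cell i : measurable (cell i).
Proof.
have mev k : measurable_fun setT (fun z => `|ev k z|).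
  by apply: measurableT_comp => //; exact: measurable_coordE.
rewrite (_ : cell i = [set z | `|ev i z| <= 1] `&`
  \bigcap_(k in [set: 'I_n]) [set z | `|ev k z| < `|ev i z| ?<= if (i <= k)%N]); last first.
  by apply/seteqP; split => z [h1 h2]; split => //= k; [move=> _; exact: h2|exact: h2].
apply: measurableI; first by apply: measurable_set_bool; exact: measurable_fun_ler.
apply: fin_bigcap_measurable; first exact: finite_finset.
move=> k _; apply: measurable_set_bool.
by case: (i <= k)%N; [exact: measurable_fun_ler|exact: measurable_fun_ltr].
Qed.

Lemma cell_le i k z : cell i z -> `|ev k z| <= `|ev i z|.
Proof. by move=> [_ /(_ k)/lteifW]. Qed.

Lemma cell_le1 i k z : cell i z -> `|ev k z| <= 1.
Proof. by move=> iz; apply: le_trans (cell_le k iz) _; case: iz. Qed.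

Lemma cell_eq i k z : cell i z -> cell k z -> i = k.
Proof.
move=> [_ iz] [_ kz]; apply/eqP; rewrite -val_eqE eqn_leq.
move: (iz k) (kz i); rewrite -!/(ev _ z).
case: leqP => ik; case: leqP => // ki /=.
- by rewrite leNgt => /negP.
- by rewrite [in X in _ -> X -> _]leNgt => h /negP.
- by move=> /lt_trans /[apply]; rewrite ltxx.
Qed.

Lemma cell_cover i0 z : (forall k, `|ev k z| <= 1) -> exists i, cell i z.
Proof.
move=> z1; have [i iz] := first_argmax (fun k => `|ev k z|) i0.
by exists i; split => // ; exact: z1.
Qed.

Lemma cellN i z : cell i z -> cell i (- z).
Proof.
have evN k : x k * (- z).1 + y k * (- z).2 = - (x k * z.1 + y k * z.2).
  by rewrite /=; ring.
by move=> [h1 h2]; split => [|k]; rewrite !evN !normrN.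
Qed.

Hypothesis spanned : exists i j, M i j != 0.

(** Two independent forms bounded by [1] confine [A] to a parallelogram, the preimage of the
    square. *)
Lemma fin_area_slabs (A : set (plane R)) : measurable A ->
  (forall z k, A z -> `|ev k z| <= 1) -> fin_area A.
Proof.
move=> mA A1; have [i [j]] := spanned; rewrite normr_eq0 => ij.
have ij' : x i * y j - y i * x j != 0 by rewrite mulrC [y i * _]mulrC mulrC.
apply: (fin_area_sub mA _ (fin_area_lin ij' fin_area_square)) => z Az.
by split; exact: A1.
Qed.

Lemma fin_area_cell i : fin_area (cell i).
Proof.
by apply: fin_area_slabs => [|z k]; [exact: measurable_cell|exact: cell_le1].
Qed.

(** The sign makes the determinant of [T j i] equal to [M i j]. Thus [eps i j * ev i] grows at the
    rate [M i j >= 0] along the direction [(y j, - x j)] of the kernel of [ev j]. *)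
Let eps i j := Num.sg (x i * y j - x j * y i).
Let T j i := lin (eps i j * x i) (eps i j * y i) (x j) (y j).

Let T1 j i z : (T j i z).1 = eps i j * ev i z.
Proof. by rewrite /T /lin /ev /=; ring. Qed.

Let T2 j i z : (T j i z).2 = ev j z.
Proof. by []. Qed.

Let detT j i : eps i j * x i * y j - eps i j * y i * x j = M i j.
Proof. by rewrite /M normrEsg /eps; ring. Qed.

Let detT0 j i : M i j != 0 -> eps i j * x i * y j - eps i j * y i * x j != 0.
Proof. by rewrite detT. Qed.

Let norm_eps j i r : M i j != 0 -> `|eps i j * r| = `|r|.
Proof.
rewrite /M normr_eq0 => ij; rewrite normrM normr_sg ij /= mul1r //.
Qed.

Let area_T j i : M i j != 0 -> area (T j i @` cell i) = area (cell i) * M i j.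
Proof.
move=> ij; rewrite area_image; [|exact: detT0|exact: fin_area_cell].
by rewrite detT /M normr_id mulrC.
Qed.

Let sum_area_T j : \sum_i area (cell i) * M i j =
  \sum_(i | M i j != 0) area (T j i @` cell i).
Proof.
rewrite (bigID (fun i => M i j != 0)) /= [X in _ + X]big1 ?addr0.
  by apply: eq_bigr => i ij; rewrite area_T.
by move=> i; rewrite negbK => /eqP ->; rewrite mulr0.
Qed.

(** For nonzero [t], one of [a + t * b] and [a - t * c] lies farther from [0] than [a]. *)
Let sg_cmp (a t b c : R) : 0 < b -> 0 < c ->
  `|a + t * b| <= `|a| -> `|a - t * c| <= `|a| -> t = 0.
Proof.
move=> b0 c0 h1 h2.
have [t0|t0|//] := ltgtP t 0.
- have tb : t * b < 0 by nra.
  have tc : t * c < 0 by nra.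
  move: h1 h2; have [a0|a0] := leP 0 a.
    rewrite (ger0_norm a0) (ger0_norm (_ : 0 <= a - t * c)); last lra.
    by lra.
  rewrite (ltr0_norm a0) (ltr0_norm (_ : a + t * b < 0)); last lra.
  by lra.
- have tb : 0 < t * b by nra.
  have tc : 0 < t * c by nra.
  move: h1 h2; have [a0|a0] := leP 0 a.
    rewrite (ger0_norm a0) (ger0_norm (_ : 0 <= a + t * b)); last lra.
    by lra.
  rewrite (ltr0_norm a0) (ltr0_norm (_ : a - t * c < 0)); last lra.
  by lra.
Qed.

(* Two points with the same image differ by a vector [t w] of [ker ev_j], along
   which all the forms [eps_i ev_i] increase strictly; hence [t = 0]. *)
Let T_disjoint j i k u : M i j != 0 -> M k j != 0 ->
  (T j i @` cell i) u -> (T j k @` cell k) u -> i = k.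
Proof.
move=> ij kj [z iz <-] [z' kz'] E.
have E2 : ev j z' = ev j z by rewrite -(T2 j k) -(T2 j i) E.
have E1 : eps k j * ev k z' = eps i j * ev i z by rewrite -!T1 E.
clear E.
have j0 : (x j != 0) || (y j != 0).
  apply: contraNT ij; rewrite negb_or !negbK => /andP[/eqP xj /eqP yj].
  by rewrite /M xj yj !(mulr0, mul0r) subr0 normr0.
have [t [tx ty]] : exists t, z'.1 = z.1 + t * y j /\ z'.2 = z.2 - t * x j.
  move: E2; rewrite /ev; have [xj|xj] := eqVneq (x j) 0 => E2; last first.
    exists ((z.2 - z'.2) / x j); split; last by field.
    apply: (mulfI xj).
    have -> : x j * z'.1 = x j * z.1 + y j * z.2 - y j * z'.2 by rewrite -E2; ring.
    by field.
  move: j0 E2; rewrite xj eqxx /= !mul0r !add0r => yj /(mulfI yj) ->.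
  by exists ((z'.1 - z.1) / y j); rewrite mulr0 subr0; split => //; field.
have shift l : eps l j * ev l z' = eps l j * ev l z + t * M l j.
  by rewrite /ev tx ty -detT; ring.
have Mi : 0 < M i j by rewrite lt0r ij /M normr_ge0.
have Mk : 0 < M k j by rewrite lt0r kj /M normr_ge0.
(* Here [a] is the common first coordinate of the two images, [a + t * M i j] is the [i]-th signed
   form at [z'], and [a - t * M k j] is the [k]-th one at [z]. Neither exceeds [a] in absolute
   value, because [z'] is in cell [k] and [z] in cell [i]. *)
have t0 : t = 0.
  apply: (sg_cmp (a := eps i j * ev i z) Mi Mk).
    by rewrite -shift -E1 !norm_eps//; exact: cell_le.
  have -> : eps i j * ev i z - t * M k j = eps k j * ev k z.
    by rewrite -E1 shift addrK.
  by rewrite !norm_eps//; exact: cell_le.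
suff zz : z' = z by move: kz'; rewrite zz; exact: cell_eq.
by move: tx ty; rewrite t0 !mul0r addr0 subr0; case: (z); case: (z') => /= ? ? ? ? -> ->.
Qed.

Lemma sum_cell_le j : \sum_i area (cell i) * M i j <= 2.
Proof.
rewrite sum_area_T -area_bigcup; last 2 first.
- by move=> i ij; apply: fin_area_image; [exact: detT0|exact: fin_area_cell].
- by move=> i k z ij kj; exact: T_disjoint.
rewrite -(area_cone (R := R) true); apply: area_le; last exact: fin_area_lty (fin_area_cone true).
move=> u; rewrite -bigcup_seq_cond => -[i /= /andP[_ ij] [z iz <-]].
rewrite /cone /mkset T1 T2 norm_eps//; split; first exact: cell_le.
exact: cell_le1 iz.
Qed.

(** If [ev j] vanishes at a point of its cell, then so do all the forms, and the point is the
    origin. *)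
Let cell_nonzero j : 0 < area (cell j) -> exists2 z, cell j z & ev j z != 0.
Proof.
move=> aj; apply/not_exists2P => h.
have h0 z : cell j z -> z = 0.
  move=> jz; have ej : ev j z = 0 by have [//|/negP] := h z; rewrite negbK => /eqP.
  have e0 k : ev k z = 0.
    by apply/eqP; rewrite -normr_le0; have := cell_le k jz; rewrite ej normr0.
  have [i [k]] := spanned; rewrite normr_eq0 => ik.
  have := e0 i; have := e0 k; rewrite /ev => ek ei.
  have z1 : z.1 = 0.
    apply: (mulfI ik); rewrite mulr0.
    transitivity (y k * (x i * z.1 + y i * z.2) - y i * (x k * z.1 + y k * z.2)).
      by ring.
    by rewrite ei ek !mulr0 subr0.
  have z2 : z.2 = 0.
    apply: (mulfI ik); rewrite mulr0.
    transitivity (x i * (x k * z.1 + y k * z.2) - x k * (x i * z.1 + y i * z.2)).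
      by ring.
    by rewrite ei ek !mulr0 subr0.
  by rewrite [z]surjective_pairing z1 z2.
have D0 : 2 * 2 - 0 * 0 != 0 :> R by apply/eqP => h'; lra.
(* A subset of the origin is stable under doubling, which multiplies areas by [4]; its area is
   therefore not positive. *)
have : area (lin 2 0 0 2 @` cell j) <= area (cell j).
  apply: area_le; last exact: fin_area_lty (fin_area_cell j).
  move=> _ [z jz <-]; move: (jz); rewrite (h0 _ jz).
  by rewrite (_ : lin _ _ _ _ _ = 0)// /lin /= !mulr0 addr0.
rewrite area_image//; last exact: fin_area_cell.
by rewrite ger0_norm; lra.
Qed.

(* Starting from a multiple of a point of [cell j], with the prescribed value of
   [ev_j], move along [ker ev_j] until the largest [|ev_i|] reaches [r]. *)
Let T_cover_pos j u : 0 < area (cell j) -> `|u.2| < u.1 -> u.1 <= 1 ->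
  exists i z, [/\ M i j != 0, cell i z & T j i z = u].
Proof.
move=> aj u12 u1; have [z0 jz0 z00] := cell_nonzero aj.
have u1_gt0 : 0 < u.1 by exact: le_lt_trans (normr_ge0 _) u12.
pose c := u.2 / ev j z0.
have [z evz] : exists z, forall k, ev k z = c * ev k z0.
  by exists (c * z0.1, c * z0.2) => k; rewrite /ev /=; ring.
have zk k : `|ev k z| <= `|u.2|.
  rewrite evz normrM /c normrM normfV -mulrA ler_piMr//.
  by rewrite mulrC ler_pdivrMr ?normr_gt0// mul1r; exact: cell_le.
have [k0 k0j] : exists k, M k j != 0.
  apply: contrapT => /forallNP kj.
  have {}kj k : x k * y j = x j * y k.
    by apply/eqP; rewrite -subr_eq0 -normr_eq0; apply/negPn/negP; exact: kj.
  have [i [k /negP]] := spanned; apply; rewrite /M normr_eq0.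
  have := z00; rewrite {1}/ev; have [xj|xj _] := eqVneq (x j) 0; last first.
    have := kj i; have := kj k => k1 k2; apply/eqP/(mulfI xj); rewrite mulr0.
    transitivity (x i * (x j * y k) - x k * (x j * y i)); first by ring.
    by rewrite -k1 -k2; ring.
  have := kj i; have := kj k; rewrite xj !mul0r add0r => /eqP k1 /eqP k2.
  rewrite mulf_eq0 negb_or => /andP[yj _].
  move: k1 k2; rewrite !mulf_eq0 (negbTE yj) !orbF => /eqP -> /eqP ->.
  by rewrite !mul0r subr0.
(* [s k] is the time at which the [k]-th signed form reaches [u.1] on the line through [z]; the
   earliest such time is [t]. *)
pose s k := (u.1 - eps k j * ev k z) / M k j.
have [i ij iP] := @arg_minP _ _ _ k0 (fun k => M k j != 0) s k0j.
pose t := s i.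
have Mgt0 k : M k j != 0 -> 0 < M k j by move=> kj; rewrite lt0r kj /M normr_ge0.
have lowk k : M k j != 0 -> - u.1 < eps k j * ev k z < u.1.
  move=> kj; rewrite -ltr_norml norm_eps//; exact: le_lt_trans (zk k) u12.
have t0 : 0 < t.
  rewrite divr_gt0 ?Mgt0// subr_gt0.
  by have /andP[] := lowk _ ij.
pose z' : plane R := (z.1 + t * y j, z.2 - t * x j).
have shift k : eps k j * ev k z' = eps k j * ev k z + t * M k j.
  by rewrite /ev /z' /= -detT; ring.
have shift0 k : M k j = 0 -> ev k z' = ev k z.
  move=> /normr0_eq0 kj; rewrite /ev /z' /=.
  transitivity (x k * z.1 + y k * z.2 + t * (x k * y j - x j * y k)); first by ring.
  by rewrite kj mulr0 addr0.
have gi : eps i j * ev i z' = u.1 by rewrite shift /t /s divfK// addrC subrK.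
have z'k k : `|ev k z'| <= u.1.
  have [kj|kj] := eqVneq (M k j) 0.
    by rewrite shift0//; apply: le_trans (zk k) _; exact: ltW.
  rewrite -(norm_eps _ kj) ler_norml shift; apply/andP; split.
    have /andP[/ltW h _] := lowk _ kj; apply: le_trans h _.
    by rewrite lerDl mulr_ge0 ?ltW ?Mgt0.
  rewrite addrC -lerBrDr -ler_pdivlMr ?Mgt0//; exact: iP.
have evjz : ev j z = u.2 by rewrite evz /c divfK.
have ejj : ev j z' = u.2.
  by rewrite shift0// /M subrr normr0.
(* Because of ties, the cell of [z'] may have an index [l] other than [i]. The signed form of [l]
   then equals [u.1] rather than [- u.1], as it starts above [- u.1] and increases. *)
have [l lz'] : exists l, cell l z'.
  by apply: (cell_cover i) => k; exact: le_trans (z'k k) u1.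
have el : `|ev l z'| = u.1.
  apply/eqP; rewrite eq_le z'k /= -gi; apply: le_trans (ler_norm _) _.
  by rewrite norm_eps//; exact: cell_le.
have lj : M l j != 0.
  apply: contraL u12 => /eqP lj0; rewrite -leNgt -el shift0//.
have gl : eps l j * ev l z' = u.1.
  have : `|eps l j * ev l z'| = u.1 by rewrite norm_eps.
  have : - u.1 < eps l j * ev l z'.
    rewrite shift; have /andP[h _] := lowk _ lj; apply: lt_le_trans h _.
    by rewrite lerDl mulr_ge0 ?ltW ?Mgt0.
  have [g0|g0] := leP 0 (eps l j * ev l z').
    by rewrite ger0_norm.
  by rewrite ltr0_norm// => h1 h2; lra.
exists l, z'; split => //.
by rewrite [u]surjective_pairing [LHS]surjective_pairing T1 T2 gl ejj.
Qed.

Let T_cover j u : 0 < area (cell j) -> cone false u ->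
  exists i z, [/\ M i j != 0, cell i z & T j i z = u].
Proof.
move=> aj [/= u12 u1]; have [u0|u0] := leP 0 u.1.
  by apply: T_cover_pos => //; rewrite -(ger0_norm u0).
have [||i [z [ij iz E]]] := @T_cover_pos j (- u) aj.
- by rewrite /= normrN; rewrite (ltr0_norm u0) in u12.
- by rewrite /=; rewrite (ltr0_norm u0) in u1.
exists i, (- z); split => //; first exact: cellN.
rewrite -[u]opprK -E /T /lin /=; congr pair; rewrite /=; ring.
Qed.

Lemma sum_cell_ge j : 0 < area (cell j) -> 2 <= \sum_i area (cell i) * M i j.
Proof.
move=> aj; rewrite sum_area_T -(area_cone (R := R) false).
apply: area_le_sum.
  by move=> i ij; apply: fin_area_image; [exact: detT0|exact: fin_area_cell].
move=> u /(T_cover aj)[i [z [ij iz E]]].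
by rewrite -bigcup_seq_cond; exists i; rewrite /= ?mem_index_enum ?ij//; exists z.
Qed.

(** Finiteness is part of the conclusion because [area] would be [0] on a set of infinite measure,
    where the inequality says nothing. *)
Lemma energy_le_area (p : 'I_n -> R) (A : set (plane R)) :
  (forall i, 0 <= p i) -> \sum_i p i = 1 ->
  (forall z k, A z -> `|ev k z| <= 1) ->
  (mu2 A < +oo)%E /\ (\sum_i \sum_j p i * p j * M i j) * area A <= 2.
Proof.
move=> p0 p1 A1; have [i0 _] := spanned.
have AU : A `<=` \big[setU/set0]_(i : 'I_n) cell i.
  move=> z Az; have [i iz] := cell_cover i0 (fun k => A1 z k Az).
  by rewrite -bigcup_seq; exists i; rewrite /= ?mem_index_enum.
have fU : fin_area (\big[setU/set0]_(i : 'I_n) cell i).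
  by apply: fin_area_bigcup => i _; exact: fin_area_cell.
split; first exact: le_lt_trans (mu2_le AU) (fin_area_lty fU).
have aA : area A <= \sum_i area (cell i).
  by apply: area_le_sum AU => i _; exact: fin_area_cell.
apply: le_trans (_ : (\sum_i \sum_j p i * p j * M i j) * \sum_i area (cell i) <= 2).
  apply: ler_wpM2l aA; apply: sumr_ge0 => i _; apply: sumr_ge0 => j _.
  by rewrite mulr_ge0 ?mulr_ge0 /M.
apply: (wedge_kernel_bound (q := fun i => area (cell i))) => //.
- by move=> i; exact: area_ge0.
- by move=> j; exact: sum_cell_le.
- by move=> j; exact: sum_cell_ge.
Qed.

End cells.

(** * Convex hulls, extreme points and interiors *)

Section convex_sets.
Context {R : realType}.
Local Notation E := (plane R).
Implicit Types (K X : set E) (x y z a b : E) (t : R).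

Lemma convex_setP K : convex_set K <->
  forall x y t, 0 <= t <= 1 -> K x -> K y -> K (t *: x + (1 - t) *: y).
Proof.
split=> [cK x y t /andP[t0 t1] Kx Ky|cK x y t]; last first.
  by rewrite !inE => Kx Ky; apply: cK; rewrite ?ge0 ?le1.
by have := cK x y (Itv01 t0 t1); rewrite !inE; apply.
Qed.

Lemma convex_conv_hull X : convex_set (conv_hull X).
Proof.
apply/convex_setP => x y t t01 Xx Xy A [/= cA XA].
move/convex_setP: (cA); apply => //; [exact: Xx|exact: Xy].
Qed.

Lemma conv_hull_min X K : convex_set K -> X `<=` K -> conv_hull X `<=` K.
Proof. by move=> cK XK x; apply. Qed.

Lemma sub_conv_hull X : X `<=` conv_hull X.
Proof. by move=> x Xx A [/= _]; apply. Qed.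

Lemma segmentP a b z : segment a b z <->
  exists2 t, 0 <= t <= 1 & z = t *: a + (1 - t) *: b.
Proof.
split=> [[t _ <-]|[t /andP[t0 t1] ->]]; last by exists (Itv01 t0 t1).
by exists t%:num => //; rewrite ge0 le1.
Qed.

Lemma extreme_pointP K x : extreme_point K x <-> K x /\
  forall y z t, K y -> K z -> 0 < t < 1 -> x = t *: y + (1 - t) *: z -> y = z.
Proof.
split=> -[Kx ex].
  split=> [|y z t Ky Kz /andP[t0 t1]]; first by move: Kx; rewrite inE.
  have := ex y z (Itv01 (ltW t0) (ltW t1)); rewrite !inE.
  by move=> /(_ Ky Kz); apply; rewrite t0.
by split=> [|y z t]; rewrite !inE// => Ky Kz t01; exact: ex.
Qed.

(* Removing an extreme point from a convex set leaves it convex. *)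
Lemma extreme_conv_hull X x : extreme_point (conv_hull X) x -> X x.
Proof.
move=> /extreme_pointP[hx ex]; apply: contrapT => Xx.
suff cX : convex_set (conv_hull X `\ x).
  have [|_] := conv_hull_min cX _ hx; last by apply.
  by move=> y Xy; split; [exact: sub_conv_hull|move=> yx; rewrite yx in Xy].
apply/convex_setP => y z t t01 [hy yx] [hz zx]; split.
  by move/convex_setP: (@convex_conv_hull X); apply.
move=> /= tyz; have [t0|t0] := eqVneq t 0.
  by apply: zx; rewrite /= -tyz t0 scale0r add0r subr0 scale1r.
have [t1|t1] := eqVneq t 1.
  by apply: yx; rewrite /= -tyz t1 subrr scale0r addr0 scale1r.
have yz : y = z.
  apply: (ex _ _ t hy hz _ (esym tyz)).
  by move: t01; rewrite !le_eqVlt eq_sym (negbTE t0) (negbTE t1).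
by apply: yx; rewrite /= -tyz yz -scalerDl addrC subrK scale1r.
Qed.

(** [phi] inverts the homothety of center [y] and ratio [t], which maps [K] into itself. Hence the
    preimage of [K] by [phi] is a neighborhood of the point and lies in [K]. *)
Lemma interior_conv K x y t : convex_set K -> K° x -> K y -> 0 < t <= 1 ->
  K° (t *: x + (1 - t) *: y).
Proof.
move=> /convex_setP cK Kx Ky /andP[t0 t1].
pose phi (z : E) : E := t^-1 *: (z - (1 - t) *: y).
have cphi : continuous phi.
  move=> z; apply: (continuous_comp (f := fun z : E => z - (1 - t) *: y)).
    by apply: continuousB; [exact: cvg_id|exact: cvg_cst].
  exact: scaler_continuous.
have phix : phi (t *: x + (1 - t) *: y) = x.
  by rewrite /phi addrK scalerA mulVf ?scale1r// gt_eqF.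
have : nbhs (t *: x + (1 - t) *: y) (phi @^-1` K) by apply: cphi; rewrite phix.
suff : phi @^-1` K `<=` K by exact: filterS.
move=> z /= Kz.
have -> : z = t *: phi z + (1 - t) *: y.
  by rewrite /phi scalerA divff ?gt_eqF// scale1r subrK.
by apply: cK => //; rewrite (ltW t0) t1.
Qed.

Lemma interior_symmetric K : convex_set K -> symmetric0 K -> K° !=set0 -> K° 0.
Proof.
move=> cK sK [x Kx].
have := interior_conv (t := 2^-1) cK Kx (sK _ (interior_subset Kx)).
have -> : 2^-1 *: x + (1 - 2^-1) *: - x = 0.
  by rewrite (_ : 1 - 2^-1 = 2^-1) ?scalerN ?subrr//; field.
by apply; rewrite invr_gt0 ltr0n invf_le1// ler1n.
Qed.

Lemma mu2_gt0 K : K° !=set0 -> (0 < mu2 K)%E.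
Proof.
move=> [x /nbhs_ballP[e /= e0 eK]].
have := mu2_le eK; apply: lt_le_trans.
have -> : ball x e = ball x.1 e `*` ball x.2 e by [].
rewrite (_ : mu2 _ = (lebesgue_measure (ball x.1 e) * lebesgue_measure (ball x.2 e))%E).
  rewrite !lebesgue_measure_ball ?ltW// -EFinM lte_fin.
  by rewrite mulr_gt0// mulrn_wgt0.
by apply: product_measure1E; exact: measurable_ball.
Qed.

Lemma convex_polygon_convex K : convex_polygon K -> convex_set K.
Proof. by move=> [_ [X _ ->]]; exact: convex_conv_hull. Qed.

End convex_sets.

(** * The energy bound for linear forms on a symmetric set *)

Section energy_bound.
Context {R : realType}.
Local Notation E := (plane R).

Lemma scalarE (g : {scalar E}) (z : E) : g z = g (1, 0) * z.1 + g (0, 1) * z.2.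
Proof.
have -> : g z = g (z.1 *: (1, 0) + z.2 *: (0, 1)).
  by congr (g _); case: z => u v; congr pair; rewrite /= scaler0 ?addr0 ?add0r;
    apply/esym/mulr1.
by rewrite linearD !linearZ /= mulrC [_ * g (0, 1)]mulrC.
Qed.

Lemma form2_norm_wedge (f g : E -> R) :
  form2_norm (wedge f g) = `|f (1, 0) * g (0, 1) - g (1, 0) * f (0, 1)|.
Proof. by rewrite /form2_norm /wedge mulrC (mulrC (g _)) [g _ * _]mulrC. Qed.

Lemma form2_norm_sum n (p : 'I_n -> R) (f : 'I_n -> E -> R) :
  form2_norm (\sum_(i < n) \sum_(j < n | (i < j)%N) (p i * p j) *: wedge (f i) (f j))
  = `|\sum_(i < n) \sum_(j < n | (i < j)%N)
       p i * p j * (f i (1, 0) * f j (0, 1) - f j (1, 0) * f i (0, 1))|.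
Proof.
rewrite /form2_norm; congr `|_|.
rewrite !fct_sumE; apply: eq_bigr => i _.
rewrite !fct_sumE; apply: eq_bigr => j _.
by rewrite /wedge /=; congr (_ * (_ - _)); rewrite mulrC.
Qed.

Lemma sum_pairs n (F : 'I_n -> 'I_n -> R) :
  (forall i, F i i = 0) -> (forall i j, F i j = F j i) ->
  \sum_i \sum_j F i j = 2 * \sum_(i < n) \sum_(j < n | (i < j)%N) F i j.
Proof.
move=> F0 FC; rewrite mulr_natl mulr2n [X in _ = _ + X](exchange_big_dep xpredT)//=.
rewrite -big_split; apply: eq_bigr => i _ /=.
rewrite (bigID (fun j : 'I_n => (i < j)%N)) /=; congr (_ + _).
rewrite (bigD1 i) ?ltnn//= F0 add0r.
apply: eq_big => [j|j _]; last exact: FC.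
by rewrite -leqNgt ltn_neqAle andbC.
Qed.

(** A nonzero [S] provides two independent forms, and the symmetry of [K] turns [f i <= 1] into
    [|f i| <= 1]. The double sum over all pairs is [2 * S], whence the constant [1]. *)
Lemma energy_bound n (K : set E) (f : 'I_n -> {scalar E}) (p : 'I_n -> R) :
  symmetric0 K -> (forall i x, K x -> f i x <= 1) ->
  (forall i, 0 <= p i) -> \sum_i p i = 1 ->
  let S := \sum_(i < n) \sum_(j < n | (i < j)%N) p i * p j * form2_norm (wedge (f i) (f j)) in
  S != 0 -> (mu2 K < +oo)%E /\ S * area K <= 1.
Proof.
move=> sK fK p0 p1 S S0.
pose x i := f i (1, 0); pose y i := f i (0, 1).
pose M i j := `|x i * y j - x j * y i|.
have S2 : \sum_i \sum_j p i * p j * M i j = 2 * S.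
  rewrite sum_pairs; last 2 first.
  - by move=> i; rewrite /M subrr normr0 mulr0.
  - by move=> i j; rewrite /M distrC [p j * _]mulrC.
  congr (_ * _); apply: eq_bigr => i _; apply: eq_bigr => j _.
  by rewrite form2_norm_wedge.
have sp : exists i j, `|x i * y j - x j * y i| != 0.
  apply: contrapT => h; move: S0; rewrite -(mulrI_eq0 _ (@mulfI _ 2 _))// -S2.
  rewrite big1 ?eqxx// => i _; rewrite big1// => j _.
  apply/eqP; rewrite mulf_eq0; apply/orP; right; apply/negPn/negP => ij.
  by apply: h; exists i, j.
have fK1 z k : K z -> `|x k * z.1 + y k * z.2| <= 1.
  move=> Kz; rewrite -scalarE ler_norml lerNl -linearN !fK//.
  exact: sK.
have [Koo] := energy_le_area sp p0 p1 fK1.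
rewrite S2 => le2; split => //.
move: le2; rewrite -mulrA; move: (S * area K) => r; lra.
Qed.

Lemma area_gt0 (K : set E) : K° !=set0 -> (mu2 K < +oo)%E -> 0 < area K.
Proof. by move=> /mu2_gt0 + Koo; rewrite mu2_area. Qed.

End energy_bound.

(** * Edges of a symmetric convex set and their supporting forms *)

Section edges.
Context {R : realType} (K : set (plane R)).
Local Notation E := (plane R).
Implicit Types (u v w x y z : E) (s t : R).

Definition det u v : R := u.1 * v.2 - u.2 * v.1.

(** By Cramer's rule, this is the sum of the coordinates of [x] in the basis [(u, v)] when [det u v]
    is nonzero, hence the linear form equal to [1] at [u] and [v]. *)
Definition side_form u v x : R := (det x v - det x u) / det u v.

Hypotheses (cK : convex_set K) (sK : symmetric0 K) (K0 : K° 0).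

Definition edge u v := u <> v /\ forall z, segment u v z -> ~ K° z.

Lemma det_span u v z : det u v != 0 ->
  z = (det z v / det u v) *: u + (det u z / det u v) *: v.
Proof.
rewrite /det => uv; case: u v z uv => [u1 u2] [v1 v2] [z1 z2] /= uv.
congr pair; rewrite /= /GRing.scale /=; field; exact: uv.
Qed.

Lemma detC u v : det v u = - det u v.
Proof. by rewrite /det; ring. Qed.

Lemma detN u v : det (- u) (- v) = det u v.
Proof. by rewrite /det /=; ring. Qed.

Lemma side_form_comb u v s t x y :
  side_form u v (s *: x + t *: y) = s * side_form u v x + t * side_form u v y.
Proof. by rewrite /side_form /det /= /GRing.scale /=; ring. Qed.

Lemma side_form1 u v : det u v != 0 -> side_form u v u = 1 /\ side_form u v v = 1.
Proof.
rewrite /side_form => uv; split.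
  by rewrite (_ : _ - det u u = det u v) ?divff// /det; ring.
by rewrite (_ : det v v - _ = det u v) ?divff// /det; ring.
Qed.

Lemma convexE s t x y : 0 <= s -> 0 <= t -> s + t = 1 -> K x -> K y ->
  K (s *: x + t *: y).
Proof.
move=> s0 t0 st; have -> : t = 1 - s by rewrite -st addrC addKr.
by move/convex_setP: cK => c Kx Ky; apply: c => //; rewrite s0 -subr_ge0; lra.
Qed.

Lemma interior_scale t x : K x -> 0 <= t < 1 -> K° (t *: x).
Proof.
move=> Kx /andP[t0 t1]; have := @interior_conv _ K 0 x (1 - t) cK K0 Kx.
by rewrite scaler0 add0r subKr; apply; apply/andP; split; lra.
Qed.

Lemma triangle_sub s t u v : 0 <= s -> 0 <= t -> s + t <= 1 -> K u -> K v ->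
  K (s *: u + t *: v).
Proof.
move=> s0 t0 st Ku Kv; have K00 := interior_subset K0.
have [e|ne] := eqVneq (s + t) 1; first exact: convexE.
have s1 : 0 < 1 - s.
  by have : s + t < 1; [rewrite lt_neqAle ne|lra].
have : K (s *: u + (1 - s) *: ((t / (1 - s)) *: v + (1 - t / (1 - s)) *: 0)).
  apply: convexE; rewrite ?subrKC ?(ltW s1)//; apply: convexE => //.
  - by rewrite divr_ge0// ltW.
  - by rewrite subr_ge0 ler_pdivrMr//; lra.
  - by rewrite subrKC.
by rewrite scaler0 addr0 scalerA mulrCA divff ?mulr1// gt_eqF.
Qed.

Lemma interior_triangle s t u v : 0 <= s -> 0 <= t -> s + t < 1 -> K u -> K v ->
  K° (s *: u + t *: v).
Proof.
move=> s0 t0 st Ku Kv; have [e|ne] := eqVneq (s + t) 0.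
  have -> : s = 0 by lra.
  have -> : t = 0 by lra.
  by rewrite !scale0r addr0.
have -> : s *: u + t *: v = (s + t) *: ((s / (s + t)) *: u + (t / (s + t)) *: v).
  by rewrite scalerDr !scalerA !(mulrC (s + t)) !divfK.
apply: interior_scale; last by rewrite st addr_ge0.
by apply: convexE; rewrite ?divr_ge0 ?addr_ge0// -mulrDl divff.
Qed.

Lemma interiorN x : K° x -> K° (- x).
Proof.
move=> Kx; have cN : continuous (fun z : E => - z).
  by move=> z; apply: continuousN; exact: cvg_id.
have : nbhs (- x) ((fun z : E => - z) @^-1` K) by apply: cN; rewrite opprK.
suff : (fun z : E => - z) @^-1` K `<=` K by exact: filterS.
by move=> z /= /sK; rewrite opprK.
Qed.

Lemma edgeC u v : edge u v -> edge v u.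
Proof.
move=> [uv uvK]; split=> [vu|z /segmentP[t t01 ->]]; first exact: uv.
apply: uvK; apply/segmentP; exists (1 - t); first by lra.
by rewrite subKr addrC.
Qed.

Lemma edgeN u v : edge u v -> edge (- u) (- v).
Proof.
move=> [uv uvK]; split=> [/oppr_inj//|z /segmentP[t t01 ->] /interiorN].
apply: uvK; apply/segmentP; exists t => //.
by rewrite !scalerN -opprD opprK.
Qed.

(** Otherwise [v = l *: u]. If [l < 0], the segment passes through the interior point [0]; if
    [0 <= l < 1] or [l > 1], one endpoint is a contraction of the other towards [0], hence interior;
    and [l = 1] means [u = v]. *)
Lemma edge_det u v : K u -> K v -> edge u v -> det u v != 0.
Proof.
move=> Ku Kv [uv uvK]; apply/eqP => d0.
have Nu : ~ K° u by apply: uvK; apply/segmentP; exists 1; rewrite ?ler01 ?lexx// subrr scale0r addr0 scale1r.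
have Nv : ~ K° v by apply: uvK; apply/segmentP; exists 0; rewrite ?ler01 ?lexx// subr0 scale0r add0r scale1r.
have u0 : u <> 0 by move=> u0; apply: Nu; rewrite u0.
have [l vl] : exists l, v = l *: u.
  have [u1|u1] := eqVneq u.1 0.
    have u2 : u.2 != 0.
      by apply/eqP => u2; apply: u0; rewrite [u]surjective_pairing u1 u2.
    have v1 : v.1 = 0.
      apply: (mulfI u2); rewrite mulr0; move: d0; rewrite /det u1 mul0r sub0r.
      by move=> /eqP; rewrite oppr_eq0 => /eqP.
    exists (v.2 / u.2); rewrite [LHS]surjective_pairing v1; congr pair.
      by rewrite /= u1 scaler0.
    by rewrite /= /GRing.scale /= divfK.
  exists (v.1 / u.1); rewrite [LHS]surjective_pairing; congr pair; rewrite /= /GRing.scale /=.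
    by rewrite divfK.
  apply: (mulfI u1); rewrite mulrA mulrCA divff// mulr1 mulrC (mulrC v.1).
  by move/eqP: d0; rewrite /det subr_eq0 mulrC => /eqP.
have [l0|l0] := ltP l 0.
  apply: (uvK 0) => //; apply/segmentP; exists (l / (l - 1)).
    apply/andP; split; first by rewrite ler_ndivlMr ?mul0r ?ltW//; lra.
    by rewrite ler_ndivrMr; lra.
  have l1 : l - 1 != 0 by apply/eqP; lra.
  rewrite vl scalerA -scalerDl (_ : _ + _ = 0) ?scale0r//.
  by field.
have [l1|l1|l1] := ltgtP l 1; last by apply: uv; rewrite vl l1 scale1r.
  by apply: Nv; rewrite vl; apply: interior_scale; rewrite ?l0.
apply: Nu; have -> : u = l^-1 *: v by rewrite vl scalerA mulVf ?scale1r// gt_eqF//; lra.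
by apply: interior_scale => //; rewrite invr_ge0 l0 invf_lt1//; lra.
Qed.

(* If [side_form u v x > 1], the midpoint [m] of the edge lies strictly between
   [x] and a point [m + s (m - x)] of the open triangle [0 u v]. *)
Lemma side_form_le1 u v x : K u -> K v -> edge u v -> K x -> side_form u v x <= 1.
Proof.
move=> Ku Kv uvE Kx; have d0 := edge_det Ku Kv uvE; have [uv uvK] := uvE.
rewrite leNgt; apply/negP => gx.
have xE := det_span x d0.
set xi := _ / _ in xE; set eta := _ / _ in xE.
have {}gx : 1 < xi + eta.
  by move: gx; rewrite xE side_form_comb; have [-> ->] := side_form1 d0; rewrite !mulr1.
have c0 : 0 < `|xi| + `|eta| + 1.
  by rewrite ltr_wpDl.
(* So small that [s * xi] and [s * eta] are at most [1 / 2], which keeps the coordinates of [y]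
   nonnegative. Their sum is [1 + s * (1 - xi - eta) < 1]. *)
pose s := (2 * (`|xi| + `|eta| + 1))^-1.
have s0 : 0 < s by rewrite invr_gt0 mulr_gt0.
have sc : s * (`|xi| + `|eta| + 1) = 2^-1 by rewrite /s; field; rewrite gt_eqF.
have sxi : s * xi <= 2^-1.
  rewrite -sc ler_pM2l//; have := ler_norm xi; have := normr_ge0 eta; lra.
have seta : s * eta <= 2^-1.
  rewrite -sc ler_pM2l//; have := ler_norm eta; have := normr_ge0 xi; lra.
pose y := (2^-1 + s * (2^-1 - xi)) *: u + (2^-1 + s * (2^-1 - eta)) *: v.
have Ky : K° y.
  apply: interior_triangle => //; rewrite ?mulrBr; [lra|lra|nra].
apply: (uvK (2^-1 *: u + (1 - 2^-1) *: v)).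
  by apply/segmentP; exists 2^-1 => //; lra.
have := interior_conv (t := (1 + s)^-1) cK Ky Kx.
have s1 : 1 + s != 0 by rewrite gt_eqF//; lra.
have -> : (1 + s)^-1 *: y + (1 - (1 + s)^-1) *: x = 2^-1 *: u + (1 - 2^-1) *: v.
  rewrite [in X in _ + X]xE /y !scalerDr !scalerA addrACA -!scalerDl.
  by congr (_ *: _ + _ *: _); field.
apply; rewrite invr_gt0 invf_le1//; lra.
Qed.

Lemma extreme_K x : extreme_point K x -> K x.
Proof. by move=> /extreme_pointP[]. Qed.

Lemma extremeE x y z s t : extreme_point K x -> K y -> K z -> 0 < s -> 0 < t ->
  s + t = 1 -> x = s *: y + t *: z -> y = z.
Proof.
move=> /extreme_pointP[_ ex] Ky Kz s0 t0 st; have -> : t = 1 - s by lra.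
by apply: ex => //; lra.
Qed.

Lemma extremeN x : extreme_point K x -> extreme_point K (- x).
Proof.
move=> ex; apply/extreme_pointP; split; first exact: sK (extreme_K ex).
move=> y z t Ky Kz t01 E0; apply: oppr_inj.
apply: (extremeE ex (sK Ky) (sK Kz) (s := t) (t := 1 - t)); [lra|lra|lra|].
by rewrite !scalerN -opprD -E0 opprK.
Qed.

(** A line carries at most two extreme points: of three distinct ones, the middle one would be a
    strict convex combination of the others. The position of [t] relative to [0] and [1] tells which
    one is in the middle. *)
Lemma extreme_collinear x y z t : extreme_point K x -> extreme_point K y ->
  extreme_point K z -> y <> z -> x = t *: y + (1 - t) *: z -> x = y \/ x = z.
Proof.
move=> ex ey ez yz xE.
have [[Kx Ky] Kz] := (extreme_K ex, extreme_K ey, extreme_K ez).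
have [t0|t0|t0] := ltgtP t 0.
- have t1 : 1 - t != 0 by rewrite gt_eqF//; lra.
  left; apply: (extremeE ez Kx Ky (s := (1 - t)^-1) (t := - t / (1 - t))).
  + by rewrite invr_gt0; lra.
  + by rewrite divr_gt0//; lra.
  + by field.
  + rewrite xE scalerDr !scalerA addrAC -scalerDl mulVf// scale1r.
    by rewrite (_ : _ * t + _ = 0) ?scale0r ?add0r//; field.
- have [t1|t1|t1] := ltgtP t 1.
  + by case: yz; apply: (extremeE ex Ky Kz t0 _ _ xE); lra.
  + have tn0 : t != 0 by rewrite gt_eqF.
    right; apply: (extremeE ey Kx Kz (s := t^-1) (t := (t - 1) / t)).
    * by rewrite invr_gt0.
    * by rewrite divr_gt0//; lra.
    * by field.
    * rewrite xE scalerDr !scalerA -addrA -scalerDl mulVf// scale1r.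
      by rewrite (_ : _ * (1 - t) + _ = 0) ?scale0r ?addr0//; field.
  + by left; rewrite xE t1 subrr scale0r addr0 scale1r.
- by right; rewrite xE t0 scale0r add0r subr0 scale1r.
Qed.

(** The determinants put [x] and [y] on the same side of the line through [0] and [b], so
    [y = al *: b + be *: x] with [be > 0]. The supporting form of each edge is at most [1] at the
    far end of the other, which forces [al + be = 1]; then [b], [x], [y] are collinear extreme
    points. *)
Lemma edge_unique b x y : extreme_point K b -> extreme_point K x ->
  extreme_point K y -> edge b x -> edge b y -> 0 < det b x * det b y -> x = y.
Proof.
move=> eb ex ey bx by_ dd.
have [[Kb Kx] Ky] := (extreme_K eb, extreme_K ex, extreme_K ey).
have dx := edge_det Kb Kx bx; have dy := edge_det Kb Ky by_.
have yE := det_span y dx.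
set al := _ / _ in yE; set be := _ / _ in yE.
have be0 : 0 < be.
  have : 0 < be * det b x ^+ 2 by rewrite /be expr2 mulrA divfK// mulrC.
  by rewrite pmulr_lgt0// exprn_even_gt0.
have h1 : al + be <= 1.
  have := side_form_le1 Kb Kx bx Ky; rewrite [y in side_form _ _ y]yE side_form_comb.
  by have [-> ->] := side_form1 dx; rewrite !mulr1.
have h2 : 1 <= al + be.
  have := side_form_le1 Kb Ky by_ Kx.
  have [sb sy] := side_form1 dy.
  have : side_form b y y = al * side_form b y b + be * side_form b y x.
    by rewrite {2}yE side_form_comb.
  by rewrite sb sy; nra.
have xy := @extreme_collinear y b x al ey eb ex (proj1 bx).
have [||//] := xy; last by move=> yb; case: (proj1 by_).
by rewrite (_ : 1 - al = be)//; lra.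
Qed.

End edges.

(** * Triangles with a vertex at the origin *)

Section triangles.
Context {R : realType}.
Local Notation E := (plane R).
Implicit Types (u v : E).

(** With [s = false] the two sides at the origin are left out, so that triangles over neighboring
    edges are disjoint. *)
Definition cone_triangle s u v : set E := lin u.1 v.1 u.2 v.2 @` std_triangle s.

Lemma lin_columns u v (z : E) : lin u.1 v.1 u.2 v.2 z = z.1 *: u + z.2 *: v.
Proof.
by rewrite /lin; congr pair; rewrite /= /GRing.scale /= ![_ * (z.1 : R)]mulrC ![_ * (z.2 : R)]mulrC.
Qed.

Let det_columns u v : u.1 * v.2 - v.1 * u.2 = det u v.
Proof. by rewrite /det; ring. Qed.

Lemma fin_area_cone_triangle s u v : det u v != 0 -> fin_area (cone_triangle s u v).
Proof.
by move=> uv; apply: fin_area_image (fin_area_std_triangle s); rewrite det_columns.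
Qed.

Lemma area_cone_triangle s u v : det u v != 0 ->
  area (cone_triangle s u v) = `|det u v| / 2.
Proof.
move=> uv; rewrite area_image ?det_columns//; last exact: fin_area_std_triangle.
by rewrite area_std_triangle.
Qed.

Lemma triangleE u v : triangle 0 u v = cone_triangle true u v.
Proof.
apply/seteqP; split.
  apply: conv_hull_min.
    apply/convex_setP => _ _ t /andP[t0 t1] [y [/= y1 y2 yS] <-] [z [/= z1 z2 zS] <-].
    exists (t *: y + (1 - t) *: z); last first.
      rewrite !lin_columns !scalerDr !scalerA /= addrACA -!scalerDl.
      by rewrite /GRing.scale /=.
    by split; rewrite /= /GRing.scale /=; nra.
  move=> z [[->|->]|->].
  - exists 0; first by split; rewrite //= addr0 ler01.
    by rewrite lin_columns !scale0r addr0.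
  - exists (1, 0); first by split; rewrite //= ?ler01// addr0.
    by rewrite lin_columns /= scale0r addr0 scale1r.
  - exists (0, 1); first by split; rewrite //= ?ler01// add0r.
    by rewrite lin_columns /= scale0r add0r scale1r.
move=> _ [z [/= z1 z2 zS] <-]; rewrite lin_columns.
have cT : convex_set (triangle 0 u v) by exact: convex_conv_hull.
have sT x : [set 0; u; v] x -> triangle 0 u v x by exact: sub_conv_hull.
have [T0 Tu Tv] : [/\ triangle 0 u v 0, triangle 0 u v u & triangle 0 u v v].
  by split; apply: sT; [left; left|left; right|right].
move/convex_setP: cT => cT.
have [e|ne] := eqVneq z.1 1.
  have -> : z.2 = 0 by move: zS; rewrite e; lra.
  by rewrite e scale1r scale0r addr0.
have z11 : 0 < 1 - z.1 by rewrite subr_gt0 lt_neqAle ne /=; lra.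
have := cT u ((z.2 / (1 - z.1)) *: v + (1 - z.2 / (1 - z.1)) *: 0) z.1.
rewrite scaler0 addr0 scalerA mulrCA divff ?gt_eqF// mulr1; apply=> //; first by lra.
have := cT v 0 (z.2 / (1 - z.1)); rewrite scaler0 addr0; apply=> //.
by rewrite divr_ge0 ?ler_pdivrMr ?(ltW z11)//; lra.
Qed.

End triangles.

(** Two telescopings: the increments before [j] add up to [A j - A 0], and then the terms in [A 0]
    collapse to [det (A 0) (A n)]. *)
Lemma sum_det_increments {R : realType} (A : nat -> plane R) n :
  \sum_(i < n) \sum_(j < n | (i < j)%N) det (A i.+1 - A i) (A j.+1 - A j)
  = \sum_(j < n) det (A j) (A j.+1) - det (A 0) (A n).
Proof.
rewrite (exchange_big_dep xpredT) //=.
have inner k w : \sum_(i < k) det (A i.+1 - A i) w = det (A k - A 0) w.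
  elim: k => [|k IH]; first by rewrite big_ord0 /det /=; ring.
  by rewrite big_ord_recr /= IH /det /=; ring.
transitivity (\sum_(j < n) det (A j - A 0) (A j.+1 - A j)).
  apply: eq_bigr => j _.
  rewrite -(big_ord_widen n (fun i => det (A i.+1 - A i) (A j.+1 - A j)) (ltnW (ltn_ord j))).
  exact: inner.
elim: n => [|n IH]; first by rewrite !big_ord0 /det; ring.
by rewrite !big_ord_recr /= IH /det /=; ring.
Qed.

Lemma energy_triangle_le {R : realType} n (p : 'I_n -> R) (f : 'I_n -> plane R -> R) :
  (forall i, 0 <= p i) ->
  form2_norm (\sum_(i < n) \sum_(j < n | (i < j)%N) (p i * p j) *: wedge (f i) (f j))
  <= \sum_(i < n) \sum_(j < n | (i < j)%N) p i * p j * form2_norm (wedge (f i) (f j)).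
Proof.
move=> p0; rewrite form2_norm_sum.
apply: le_trans (ler_norm_sum _ _ _) _; apply: ler_sum => i _.
apply: le_trans (ler_norm_sum _ _ _) _; apply: ler_sum => j _.
by rewrite form2_norm_wedge normrM ger0_norm// mulr_ge0.
Qed.

(** * The symmetric polygon with [2n] vertices and the case of equality *)

Section symmetric_gon.
Context {R : realType} (n : nat) (K : set (plane R)) (a : 'I_(n + n) -> plane R).
Hypotheses (sK : symmetric0 K) (aK : convex_gon a K).
Local Notation E := (plane R).

Let pK : convex_polygon K. Proof. by case: aK. Qed.
Let cK : convex_set K. Proof. exact: convex_polygon_convex. Qed.
Let K0 : K° 0. Proof. by apply: interior_symmetric => //; case: pK. Qed.

Let K_range : K = conv_hull (range a). Proof. by case: aK. Qed.

Lemma gon_gt0 : (0 < n)%N.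
Proof.
rewrite lt0n; apply/eqP => n0.
have h : conv_hull (range a) `<=` set0.
  apply: conv_hull_min; first by move=> x y t; rewrite inE.
  by move=> x [[i im] _ _]; exfalso; move: im; rewrite n0.
by apply: (h 0); rewrite -K_range; exact: interior_subset.
Qed.

Let m := (n + n)%N.
Let m_gt0 : (0 < m)%N. Proof. by rewrite /m addn_gt0 gon_gt0. Qed.

(** Vertices indexed by all natural numbers modulo [m], so that successors and the half turn [n + k]
    are plain arithmetic. *)
Let A (k : nat) : E := a (Ordinal (ltn_pmod k m_gt0)).

Let AE (i : 'I_m) : a i = A i.
Proof. by congr a; apply/val_inj; rewrite /= modn_small. Qed.

Let ASE (i : 'I_m) : a (ordS i) = A i.+1.
Proof. by congr a; apply/val_inj. Qed.

Let A_mod k l : k = l %[mod m] -> A k = A l.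
Proof. by move=> kl; congr a; apply/val_inj. Qed.

Let A_inj k l : A k = A l -> k = l %[mod m].
Proof. by case: aK => _ inj _ _ _ /inj[]. Qed.

Let ext k : extreme_point K (A k).
Proof. by case: aK => _ _ _ h _; exact: h. Qed.

Let AK k : K (A k). Proof. exact: extreme_K (ext k). Qed.

Let A_edge k : edge K (A k) (A k.+1).
Proof.
split.
  move=> /A_inj; rewrite -addn1 -[X in X = _ %[mod _]]addn0 => /eqP.
  rewrite eqn_modDl modn_small// modn_small//.
  by rewrite /m; move: gon_gt0; case: (n) => // k'; rewrite addnS.
move=> z; have -> : A k.+1 = a (ordS (Ordinal (ltn_pmod k m_gt0))).
  by rewrite ASE; apply: A_mod; rewrite /= -addn1 -[in RHS]addn1 modnDml.
by case: aK => _ _ _ _ /[apply] -[].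
Qed.

Let d k := det (A k) (A k.+1).

Let d_neq0 k : d k != 0.
Proof. exact: (edge_det cK K0). Qed.

Let A_neq0 k : A k <> 0.
Proof.
by move=> Ak; have := d_neq0 k; rewrite /d Ak /det /= !mul0r subrr eqxx.
Qed.

(** The opposite of a vertex is again extreme, and an extreme point of the hull of the vertices is a
    vertex. *)
Let A_opp k : exists2 l, (l < m)%N & - A k = A l.
Proof.
have := extremeN sK (ext k); rewrite K_range => /extreme_conv_hull[l _ <-].
by exists l; rewrite ?AE.
Qed.

(** Equality forces [m = 2], so that [- A k] is [A k] or [A k.+1]. The former would be zero, and the
    latter would make [d k] vanish. *)
Let A_neqS2 k : A k <> A k.+2.
Proof.
move=> k2.
have m2 : m = 2.
  have : (m %| 2)%N.
    by move/A_inj/eqP: k2; rewrite -addn2 -[X in X == _ %[mod _]]addn0 eqn_modDl mod0n eq_sym.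
  move=> /(@dvdn_leq _ 2 isT); move: gon_gt0; rewrite /m.
  by case: (n) => // -[|k']//; rewrite addnS.
have [l lm kl] := A_opp k.
have : A l = A k \/ A l = A k.+1.
  have: (l %% m = k %% m \/ l %% m = k.+1 %% m)%N.
    by rewrite m2 !modn2 /=; case: (odd l); case: (odd k); [left|right|right|left].
  by case=> /A_mod ->; [left|right].
case=> lk; move: kl; rewrite lk.
  move=> /eqP; rewrite -subr_eq0 -opprD oppr_eq0 -mulr2n -scaler_nat.
  by rewrite scaler_eq0 pnatr_eq0 /= => /eqP; exact: A_neq0.
move=> kS; have /eqP : d k = 0 by rewrite /d -kS /det /=; ring.
by rewrite (negbTE (d_neq0 k)).
Qed.

(** With opposite signs, [A k] and [A k.+2] would be neighbors of [A k.+1] on the same side of its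
    line through [0], hence equal. *)
Let d_mulS_gt0 k : 0 < d k * d k.+1.
Proof.
have dd : d k * d k.+1 != 0 by rewrite mulf_neq0 ?d_neq0.
rewrite lt0r dd /= leNgt; apply/negP => lt0.
apply: (@A_neqS2 k); apply: (edge_unique cK K0 (ext k.+1)) => //.
- exact: edgeC.
- by rewrite detC mulNr oppr_gt0.
Qed.

Let d_mul_gt0 k l : 0 < d k * d l.
Proof.
have d0 j : 0 < d 0 * d j.
  elim: j => [|j IH]; first by rewrite -expr2 exprn_even_gt0 ?d_neq0.
  have := mulr_gt0 IH (d_mulS_gt0 j).
  have -> : d 0 * d j * (d j * d j.+1) = (d 0 * d j.+1) * d j ^+ 2 by ring.
  by rewrite pmulr_lgt0// exprn_even_gt0 ?d_neq0.
have := mulr_gt0 (d0 k) (d0 l).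
have -> : d 0 * d k * (d 0 * d l) = (d k * d l) * d 0 ^+ 2 by ring.
by rewrite pmulr_lgt0// exprn_even_gt0 ?d_neq0.
Qed.

(* The opposite of [A 0] is some [A l]; uniqueness of the next edge propagates
   this to [- A k = A (l + k)], and then [A 0 = A (l + l)] forces [l = n]. *)
Let A_addn k : A (n + k) = - A k.
Proof.
have [l lm l0] := A_opp 0.
have Al j : - A j = A (l + j).
  elim: j => [|j IH]; first by rewrite addn0.
  rewrite addnS; apply: (edge_unique cK K0 (b := - A j)).
  - exact: extremeN.
  - exact: extremeN.
  - exact: ext.
  - exact: edgeN.
  - by rewrite IH.
  - by rewrite detN {1}IH; exact: d_mul_gt0.
have : A 0 = A (l + l) by rewrite -Al -l0 opprK.
move=> /A_inj/esym/eqP; rewrite mod0n => /dvdnP[q lq].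
(* Since [l < m], only [q = 0] is left to exclude; it gives [l = 0] and makes [A 0] its own
   opposite. *)
have q1 : q = 1%N.
  have : (q < 2)%N by rewrite -(ltn_pmul2r m_gt0) -lq mul2n -addnn -addSn leq_add// ltnW.
  case: q lq => [|[]]// lq _; exfalso.
  have l00 : l = 0%N by case: (l) lq.
  have /eqP := l0; rewrite l00 eq_sym -subr_eq0 opprK -mulr2n -scaler_nat.
  by rewrite scaler_eq0 pnatr_eq0 /= => /eqP; exact: A_neq0.
have -> : n = l by move: lq; rewrite q1 mul1n /m !addnn => /double_inj.
by rewrite -Al.
Qed.

Let d_addn k : d (n + k) = d k.
Proof. by rewrite /d -addnS !A_addn detN. Qed.

Let sup k := side_form (A k) (A k.+1).

Let sup_le1 k x : K x -> sup k x <= 1.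
Proof. exact: (side_form_le1 cK K0). Qed.

Let tri k := cone_triangle false (A k) (A k.+1).

Let sup_vertex k l : 1 <= sup l (A k) -> A k = A l \/ A k = A l.+1.
Proof.
move=> k1; have {}k1 : sup l (A k) = 1 by apply/eqP; rewrite eq_le sup_le1.
have kE := det_span (A k) (d_neq0 l).
apply: (@extreme_collinear _ K _ _ _ _ (ext k) (ext l) (ext l.+1) (proj1 (A_edge l))).
rewrite [LHS]kE; congr (_ *: _ + _ *: _).
move: k1; rewrite /sup /side_form -/(d l) mulrBl => <-.
by rewrite (detC (A k)) mulNr; ring.
Qed.

Let tri_comb k l z : tri k z -> exists s t,
  [/\ 0 < s, 0 < t, s + t = sup k z & s * sup l (A k) + t * sup l (A k.+1) = sup l z].
Proof.
move=> [u [/= s0 t0 st] <-]; exists u.1, u.2; split=> //; rewrite lin_columns.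
  by rewrite /sup side_form_comb; have [-> ->] := side_form1 (d_neq0 k); rewrite !mulr1.
by rewrite /sup side_form_comb.
Qed.

(** With [s], [t] the positive coordinates of [z] over edge [k], [sup l z <= s + t = sup k z]; by
    symmetry equality holds, and so [sup l] is [1] at both ends of edge [k]. These are then the ends
    of edge [l], in the same order because all the [d] have the same sign. *)
Let tri_disjoint k l z : (k < m)%N -> (l < m)%N -> tri k z -> tri l z -> k = l.
Proof.
move=> km lm kz lz.
have [s [t [s0 t0 st E]]] := tri_comb l kz.
have [s' [t' [s'0 t'0 st' E']]] := tri_comb k lz.
have h1 := sup_le1 l (AK k); have h2 := sup_le1 l (AK k.+1).
have h1' := sup_le1 k (AK l); have h2' := sup_le1 k (AK l.+1).
have e : sup k z = sup l z by apply/eqP; rewrite eq_le; apply/andP; split; nra.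
have k1 : 1 <= sup l (A k) by nra.
have k2 : 1 <= sup l (A k.+1) by nra.
have kl : A k = A l -> k = l by move=> /A_inj; rewrite !modn_small.
have [/kl//|kl1] := sup_vertex k1.
have [kl2|kl2] := sup_vertex k2.
  have := d_mul_gt0 k l; rewrite /d kl1 kl2 detC mulNr oppr_gt0 ltNge.
  by rewrite -expr2 sqr_ge0.
by case: (proj1 (A_edge k)); rewrite kl1 kl2.
Qed.

Let D := \sum_(i < n) `|d i|.

Let D_gt0 : 0 < D.
Proof.
rewrite /D; have : (0 < n)%N by exact: gon_gt0.
case: (n) => // k _; rewrite big_ord_recl ltr_pwDl ?normr_gt0 ?d_neq0//.
exact: sumr_ge0.
Qed.

Let norm_sum_d : `|\sum_(i < n) d i| = D.
Proof.
have dE k : d k = Num.sg (d 0) * `|d k|.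
  have [d0|d0|d0] := ltgtP (d 0) 0.
  - by rewrite ltr0_sg// ltr0_norm ?mulN1r ?opprK//; have := d_mul_gt0 0 k; nra.
  - by rewrite gtr0_sg// gtr0_norm ?mul1r//; have := d_mul_gt0 0 k; nra.
  - by have := d_neq0 0; rewrite d0 eqxx.
under eq_bigr do rewrite dE.
by rewrite -mulr_sumr normrM normr_sg d_neq0 mul1r ger0_norm// ltW.
Qed.

(** The triangle over edge [i] has area [|d i| / 2], and the opposite one has the same area, so the
    [n + n] disjoint triangles in [K] add up to [D]. *)
Let D_le_area : (mu2 K < +oo)%E -> D <= area K.
Proof.
move=> Koo.
have ft k : fin_area (tri k) by exact: fin_area_cone_triangle (d_neq0 k).
have -> : D = \sum_(i < n + n) area (tri i).
  rewrite big_split_ord /= /D -big_split /=; apply: eq_bigr => i _.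
  by rewrite /tri !(area_cone_triangle _ (d_neq0 _)) -!/(d _) d_addn; field.
rewrite -area_bigcup//.
- apply: area_le => // z; rewrite -bigcup_seq => -[k _ [w [/= w1 w2 w12] <-]].
  by rewrite lin_columns; apply: (triangle_sub cK K0) => //; exact: ltW.
- move=> i j z _ _ iz jz; apply/val_inj; exact: tri_disjoint iz jz.
Qed.

Lemma gon_energy (f : 'I_n -> {scalar E}) (p : 'I_n -> R) :
  (forall (i : 'I_n) x,
     segment (a (lshift n i)) (a (ordS (lshift n i))) x -> f i x = 1) ->
  (forall i : 'I_n,
     p i = 2 * area (triangle 0 (a (lshift n i)) (a (ordS (lshift n i)))) / area K) ->
  let N := form2_norm (\sum_(i < n) \sum_(j < n | (i < j)%N)
                         (p i * p j) *: wedge (f i) (f j)) in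
  let S := \sum_(i < n) \sum_(j < n | (i < j)%N)
             p i * p j * form2_norm (wedge (f i) (f j)) in
  N = S /\ S = (area K)^-1.
Proof.
move=> f1 pE N S.
have fE i x : f i x = sup i x.
  have fi : f i (A i) = 1.
    apply: f1; rewrite ASE AE; apply/segmentP; exists 1; first by rewrite ler01 lexx.
    by rewrite subrr scale0r addr0 scale1r.
  have fiS : f i (A i.+1) = 1.
    apply: f1; rewrite ASE AE; apply/segmentP; exists 0; first by rewrite ler01 lexx.
    by rewrite subr0 scale0r add0r scale1r.
  rewrite [in LHS](det_span x (d_neq0 i)) linearD !linearZ /= fi fiS !mulr1.
  by rewrite (detC x) mulNr -mulrBl.
have wE i j : f i (1, 0) * f j (0, 1) - f j (1, 0) * f i (0, 1) =
    det (A i.+1 - A i) (A j.+1 - A j) / (d i * d j).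
  rewrite !fE /sup /side_form -!/(d _).
  have di := d_neq0 i; have dj := d_neq0 j; set di' := d i in di *; set dj' := d j in dj *.
  by rewrite /det /=; field; rewrite di dj.
(* Normalized by [D], the weights add up to [1] by construction, so the energy bound applies before
   [area K = D] is known. *)
pose q (i : 'I_n) := `|d i| / D.
have q0 i : 0 <= q i by rewrite divr_ge0 ?(ltW D_gt0).
have q1 : \sum_i q i = 1 by rewrite -mulr_suml divff// gt_eqF.
pose Nq := form2_norm (\sum_(i < n) \sum_(j < n | (i < j)%N)
                         (q i * q j) *: wedge (f i) (f j)).
pose Sq := \sum_(i < n) \sum_(j < n | (i < j)%N)
             q i * q j * form2_norm (wedge (f i) (f j)).
have NqE : Nq = D^-1.
  rewrite /Nq form2_norm_sum.
  transitivity `|\sum_(i < n) \sum_(j < n | (i < j)%N)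
      D ^- 2 * det (A i.+1 - A i) (A j.+1 - A j)|.
    congr `|_|; apply: eq_bigr => i _; apply: eq_bigr => j _.
    rewrite wE /q.
    have -> : `|d i| / D * (`|d j| / D) = D ^- 2 * (d i * d j).
      by rewrite -[d i * d j]ger0_norm ?ltW// normrM; field; rewrite gt_eqF.
    by rewrite -mulrA; congr (_ * _); rewrite mulrC divfK// mulf_neq0 ?d_neq0.
  under eq_bigr do rewrite -mulr_sumr.
  rewrite -mulr_sumr sum_det_increments.
  (* The last term of the telescoping vanishes because [A n = - A 0]. *)
  have -> : det (A 0) (A n) = 0 by rewrite -[n]addn0 A_addn /det /=; ring.
  rewrite subr0 normrM norm_sum_d ger0_norm ?invr_ge0 ?exprn_even_ge0//.
  by field; rewrite gt_eqF.
have NSq : Nq <= Sq by exact: energy_triangle_le.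
have Sq_gt0 : 0 < Sq by apply: lt_le_trans NSq; rewrite NqE invr_gt0.
have fK i x : K x -> f i x <= 1 by move=> Kx; rewrite fE sup_le1.
have [Koo SqK] := energy_bound sK fK q0 q1 (lt0r_neq0 Sq_gt0).
have DK := D_le_area Koo.
(* From [D^-1 = Nq <= Sq] and [Sq * area K <= 1] follows [area K <= D]. *)
have KD : area K = D.
  apply/eqP; rewrite eq_le DK andbT.
  rewrite -(ler_pM2l (x := D^-1)) ?invr_gt0// mulVf ?gt_eqF//.
  by apply: le_trans SqK; rewrite -NqE; apply: ler_wpM2r NSq; exact: area_ge0.
have SqE : Sq = D^-1.
  apply/eqP; rewrite eq_le -{2}NqE NSq andbT.
  by move: SqK; rewrite KD -ler_pdivlMr// mul1r.
(* Once [area K = D], the prescribed weights are the ones already treated. *)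
have pq : p = q.
  apply/funext => i; rewrite pE ASE AE triangleE (area_cone_triangle _ (d_neq0 i)) KD.
  by rewrite /q -/(d i); field; rewrite gt_eqF.
by rewrite /N /S pq -/Nq -/Sq NqE SqE KD.
Qed.

End symmetric_gon.

Theorem proposition2p2 (R : realType) (n : nat) (K : set (plane R))
    (f : 'I_n -> {scalar plane R}) (p : 'I_n -> R) 
    (hK : convex_polygon K) (hsym : symmetric0 K) :
  ((forall i x, K x -> f i x <= 1) ->
   (forall i, 0 <= p i) -> \sum_(i < n) p i = 1 ->
   form2_norm (\sum_(i < n) \sum_(j < n | (i < j)%N)
                 (p i * p j) *: wedge (f i) (f j))
     <= \sum_(i < n) \sum_(j < n | (i < j)%N)
          p i * p j * form2_norm (wedge (f i) (f j))
     <= (area K)^-1)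
  /\
  (forall a : 'I_(n + n) -> plane R,
     convex_gon a K ->
     (forall (i : 'I_n) x,
        segment (a (lshift n i)) (a (ordS (lshift n i))) x -> f i x = 1) ->
     (forall i : 'I_n,
        p i = 2 * area (triangle 0 (a (lshift n i)) (a (ordS (lshift n i))))
                / area K) ->
     form2_norm (\sum_(i < n) \sum_(j < n | (i < j)%N)
                   (p i * p j) *: wedge (f i) (f j))
       = \sum_(i < n) \sum_(j < n | (i < j)%N)
            p i * p j * form2_norm (wedge (f i) (f j))
     /\ \sum_(i < n) \sum_(j < n | (i < j)%N)
            p i * p j * form2_norm (wedge (f i) (f j))
       = (area K)^-1).
Proof.
split=> [fK p0 p1|a aK f1 pE]; last first.
  exact: (gon_energy hsym aK f1 pE).
apply/andP; split; first exact: energy_triangle_le.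
(* For [S = 0] the forms may fail to span the plane, and the bound reduces to the nonnegativity of
   the area. *)
set S := \sum_(i < n) _; have [->|S0] := eqVneq S 0.
  by rewrite invr_ge0 area_ge0.
have [Koo SK] := energy_bound hsym fK p0 p1 S0.
by rewrite -[_^-1]mul1r ler_pdivlMr//; apply: area_gt0 => //; case: hK.
Qed.
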